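(* Let $p\ge1$, let $m\ge 2$ be an integer, let $Q$ be a fixed cube in $\mathbf{R}^N$ and let $\mathcal{A}\subset W^{m,p}(Q)_+$, i.e. $\mathcal{A}$ is a set of nonnegative functions in $W^{m,p}(Q)$. Then, for $\alpha$ sufficiently large and some positive $\alpha'$, $$\Theta^{\alpha}_{m,1,p}(\mathcal{A})\ge c\;\Theta^{\alpha'}_{m,0,p}(\mathcal{A}),$$ where the constant $c>0$ depends only on $N$, $m$, $p$ and $\alpha$.
   Context: The cube $Q$ is normalized to have unit side length, with the origin of coordinates at its centre. $\|\nabla^k u\|_{L^p(Q)}=\sum_{|\beta|=k}\|D^\beta u\|_{L^p(Q)}$ (sum over multiindices), and $W^{m,p}(Q)$ is the Sobolev space with norm $\sum_{k=0}^m\|\nabla^k u\|_{L^p(Q)}$. $\mathcal{P}_r$ is the set of polynomials on $\mathbf{R}^N$ of degree at most $r$. For $u\in W^{r+1,p}(Q)$, $\Pi_{r,r,p}u$ denotes a polynomial $P\in\mathcal{P}_r$ attaining $\inf_{P\in\mathcal{P}_r}\sum_{i=0}^r\|\nabla^i(u-P)\|_{L^p(Q)}$ (unique if $p>1$; a minimizer if $p=1$). For $0\le r'\le r$, $\Pi_{r,r',p}u$ is the part of degree at most $r'$ of the polynomial $\Pi_{r,r,p}u$, and $\Pi^{\mathrm{co}}_{r,r',p}u=\Pi_{r,r,p}u-\Pi_{r,r',p}u$. For $\alpha>0$, $0\le k\le m-1$ and $\mathcal{A}\subset W^{m,p}(Q)$, let $T^{\alpha}_{m,k,p,\mathcal{A}}$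 be the set of $u\in\mathcal{A}$ with $$\|\Pi_{m-1,k,p}u\|_{L^p(Q)}\ge\alpha\|\Pi^{\mathrm{co}}_{m-1,k,p}u\|_{L^p(Q)}\quad\text{and}\quad\|u-\Pi_{m-1,m-1,p}u\|_{L^p(Q)}\le\tfrac12\|\Pi_{m-1,m-1,p}u\|_{L^p(Q)}.$$ Then $$\Theta^{\alpha}_{m,k,p}(\mathcal{A})=\min\left[\inf_{u\in T^{\alpha}_{m,k,p,\mathcal{A}}}\frac{\|\nabla^m u\|^p_{L^p(Q)}}{\|\Pi_{m-1,k,p}u\|^p_{L^p(Q)}},\,1\right],$$ where $u=0$ (the only element for which the denominator vanishes) is disregarded and the infimum over the empty set is $+\infty$. *)

(* Defs.v *)
From HB Require Import structures.
From mathcomp Require Import all_boot all_order all_algebra.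
(* The notations of mpoly clash with those of mathcomp-analysis. *)
From mathcomp.multinomials Require Import -(notations) mpoly.
From mathcomp Require Import all_classical all_reals all_analysis.
Set Implicit Arguments.
Unset Strict Implicit.
Unset Printing Implicit Defensive.
Import Order.TTheory GRing.Theory Num.Theory.
Import numFieldNormedType.Exports.
Local Open Scope classical_set_scope.
Local Open Scope ring_scope.

Definition measure_row_display : measure_display -> measure_display.
Proof. exact. Qed.

Section measurable_row.
Context {d} {T : measurableType d}.
Variable n : nat.

Definition coord_preimage : set (set 'rV[T]_n) :=
  [set A | exists (i : 'I_n) (B : set T),
     measurable B /\ A = (fun x : 'rV[T]_n => x 0 i) @^-1` B].

Let row_set0 : <<s coord_preimage >> set0.
Proof. exact: sigma_algebra0. Qed.

Let row_setC A : <<s coord_preimage >> A -> <<s coord_preimage >> (~` A).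
Proof. exact: sigma_algebraC. Qed.

Let row_bigcup (F : _^nat) : (forall i, <<s coord_preimage >> (F i)) ->
  <<s coord_preimage >> (\bigcup_i (F i)).
Proof. exact: sigma_algebra_bigcup. Qed.

HB.instance Definition _ := @isMeasurable.Build (measure_row_display d)
  'rV[T]_n <<s coord_preimage >> row_set0 row_setC row_bigcup.

Lemma measurable_coord (i : 'I_n) :
  measurable_fun setT (fun x : 'rV[T]_n => x 0 i).
Proof.
move=> _ B mB; rewrite setTI; apply: sub_sigma_algebra.
by exists i, B.
Qed.

Lemma measurable_fun_row d' (S : measurableType d') (f : S -> 'rV[T]_n) :
  (forall i, measurable_fun setT (fun s => f s 0 i)) -> measurable_fun setT f.
Proof.
move=> mf; apply: (measurability coord_preimage) => //.
move=> _ [_ [i [B [mB ->]]] <-].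
by have := mf i measurableT B mB.
Qed.

End measurable_row.

(* The library declares this instance, but canonical inference only finds the
   one for subprobability measures. *)
Lemma sigma_finite_product d1 d2 (T1 : measurableType d1)
    (T2 : measurableType d2) (R : realType)
    (m1 : {sigma_finite_measure set T1 -> \bar R})
    (m2 : {sigma_finite_measure set T2 -> \bar R}) :
  sigma_finite setT (m1 \x m2)%E.
Proof.
have /sigma_finiteP[F [TF ndF Foo]] := sigma_finiteT m1.
have /sigma_finiteP[G [TG ndG Goo]] := sigma_finiteT m2.
exists (fun n => F n `*` G n).
  rewrite -setXTT TF TG; apply/seteqP; split=> [[x y]|[x y] [n _ [/= ? ?]]].
    move=> [/= [n _ Fnx] [k _ Gky]]; exists (maxn n k) => //; split.
      by move: x Fnx; exact/subsetPset/ndF/leq_maxl.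
    by move: y Gky; exact/subsetPset/ndG/leq_maxr.
  by split; exists n.
move=> k; have [? ?] := Foo k; have [? ?] := Goo k.
split; first exact: measurableX.
by rewrite product_measure1E// lte_mul_pinfty// ge0_fin_numE.
Qed.

Section lebesgue_row.
Variable R : realType.

Definition row_cons n (z : R * 'rV[R]_n) : 'rV[R]_n.+1 :=
  \row_i (if unlift ord0 i is Some j then z.2 0 j else z.1).

Definition row_uncons n (x : 'rV[R]_n.+1) : R * 'rV[R]_n :=
  (x 0 ord0, \row_j x 0 (lift ord0 j)).

Lemma row_consK n : cancel (@row_cons n) (@row_uncons n).
Proof.
case=> a y; rewrite /row_uncons mxE unlift_none; congr pair.
by apply/rowP => j; rewrite !mxE liftK.
Qed.

Lemma measurable_row_cons n : measurable_fun setT (@row_cons n).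
Proof.
apply: measurable_fun_row => i; under eq_fun do rewrite mxE.
case: unliftP => [j _|_]; last exact: measurable_fst.
exact: (measurableT_comp (measurable_coord j) measurable_snd).
Qed.

Lemma measurable_row_uncons n : measurable_fun setT (@row_uncons n).
Proof.
apply: (@measurable_fun_pair _ _ _ _ _ _ (fun x : 'rV[R]_n.+1 => x 0 ord0)).
  exact: measurable_coord.
apply: measurable_fun_row => i; under eq_fun do rewrite mxE.
exact: measurable_coord.
Qed.

Section step.
Variables (n : nat) (mu : {sigma_finite_measure set 'rV[R]_n -> \bar R}).

Definition lebesgue_row_step : set 'rV[R]_n.+1 -> \bar R :=
  pushforward (@lebesgue_measure R \x mu)%E (@row_cons n).

Let step0 : lebesgue_row_step set0 = 0%E.
Proof. by rewrite /lebesgue_row_step /pushforward preimage_set0 measure0. Qed.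

Let step_ge0 A : (0 <= lebesgue_row_step A)%E.
Proof. exact: (measure_ge0 (@lebesgue_measure R \x mu)%E). Qed.

Let step_sigma_additive : semi_sigma_additive lebesgue_row_step.
Proof.
pose m := (@lebesgue_measure R \x mu)%E.
exact: (@measure_semi_sigma_additive _ _ _
  (measure_function_pushforward__canonical__measure_function_Measure
     m (@measurable_row_cons n))).
Qed.

HB.instance Definition _ := isMeasure.Build _ _ _ lebesgue_row_step
  step0 step_ge0 step_sigma_additive.

Let step_sigma_finite : sigma_finite setT lebesgue_row_step.
Proof.
have [F FT Foo] := sigma_finite_product (@lebesgue_measure R) mu.
exists (fun k => @row_uncons n @^-1` F k).
  by rewrite -preimage_bigcup -FT preimage_setT.
move=> k; have [mF Fk] := Foo k; split.
  by rewrite -[X in measurable X]setTI; exact: measurable_row_uncons.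
rewrite /lebesgue_row_step /pushforward -comp_preimage.
by rewrite (_ : _ \o _ = id) ?preimage_id//; apply/funext => z; exact: row_consK.
Qed.

HB.instance Definition _ := Measure_isSigmaFinite.Build _ _ _ lebesgue_row_step
  step_sigma_finite.

End step.

(* The Lebesgue measure on R^n: the unit mass on R^0, then the product of the
   one-dimensional Lebesgue measure with the one on the last n coordinates. *)
Fixpoint lebesgue_row n : {sigma_finite_measure set 'rV[R]_n -> \bar R} :=
  if n is n'.+1 then lebesgue_row_step (lebesgue_row n') else \d_ (0 : 'rV[R]_0).

Lemma lebesgue_row_box n (B : 'I_n -> set R) :
  (forall i, measurable (B i)) ->
  lebesgue_row n [set x | forall i, B i (x 0 i)] =
  (\prod_(i < n) @lebesgue_measure R (B i))%E.
Proof.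
elim: n B => [|n IH] B mB.
  rewrite big_ord0 /= diracE (_ : _ \in _) //.
  by rewrite inE => -[].
rewrite big_ord_recl -(IH (fun i => B (lift ord0 i)))//.
pose C := [set x : 'rV[R]_n | forall i, B (lift ord0 i) (x 0 i)].
have mC : measurable C.
  have -> : C = \big[setI/setT]_(i < n)
      ((fun x : 'rV[R]_n => x 0 i) @^-1` B (lift ord0 i)).
    apply/seteqP; split => [x Cx|x]; first by rewrite -bigcap_seq => i _; exact: Cx.
    by rewrite -bigcap_seq => Cx i; apply: (Cx i); rewrite /= mem_index_enum.
  apply: bigsetI_measurable => i _; rewrite -[X in measurable X]setTI.
  exact: measurable_coord.
rewrite -product_measure1E//=; last exact: mB.
rewrite /lebesgue_row_step /pushforward.
congr product_measure1; apply/seteqP; split=> [[a y] /= h|[a y] /= [ha hy] i].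
  split => [|i]; first by have := h ord0; rewrite mxE unlift_none.
  by have := h (lift ord0 i); rewrite mxE liftK.
by rewrite mxE; case: unliftP => [j ->|->].
Qed.

End lebesgue_row.

Section cube.
Variables (R : realType) (N : nat).
Implicit Types (p : R) (b : multinom N) (f u v : 'rV[R]_N -> R).

Definition cube : set 'rV[R]_N := [set x | forall i, `|x 0 i| < 2^-1].

Lemma measurable_cube : measurable cube.
Proof.
have -> : cube = \big[setI/setT]_(i < N)
    ((fun x : 'rV[R]_N => x 0 i) @^-1` [set` `]- 2^-1, 2^-1[]).
  apply/seteqP; split => x; rewrite -bigcap_seq => Cx i.
    by move=> _; rewrite /= in_itv/= -ltr_norml; exact: Cx.
  by have := Cx i (mem_index_enum i); rewrite /= in_itv/= -ltr_norml.
apply: bigsetI_measurable => i _; rewrite -[X in measurable X]setTI.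
by apply: measurable_coord => //; exact: measurable_itv.
Qed.

(* A function on the cube is encoded by any Borel extension to R^N; all norms
   and integrals below only see its restriction to the cube. *)
Definition cube_measure : {measure set 'rV[R]_N -> \bar R} :=
  mrestr (lebesgue_row R N) measurable_cube.

Definition Lpnorm p f : R := fine ('N[cube_measure]_(p%:E)[EFin \o f])%E.

Definition partial (i : 'I_N) f : 'rV[R]_N -> R := fun x => 'D_('e_i) f x.

Definition smooth f := forall s : seq 'I_N,
  continuous (foldr partial f s) /\
  forall i x, derivable (foldr partial f s) x 'e_i.

Definition mpartial b f : 'rV[R]_N -> R :=
  foldr (fun i => iter (b i) (partial i)) f (enum 'I_N).

Definition test_function f :=
  let supp := closure [set x | f x != 0] in
  [/\ smooth f, compact supp & supp `<=` cube].

Definition weak_derivative b u v := forall phi, test_function phi ->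
  \int[cube_measure]_x (u x * mpartial b phi x) =
  (-1) ^+ mdeg b * \int[cube_measure]_x (v x * phi x).

Definition sobolev (m : nat) p : set ('rV[R]_N -> R) :=
  [set u | u \in Lfun cube_measure p%:E /\
    forall b, (mdeg b <= m)%N ->
      exists2 v, v \in Lfun cube_measure p%:E & weak_derivative b u v].

(* A representative of D^b u, which is unique up to a null set. *)
Definition wderive p b u : 'rV[R]_N -> R :=
  xget (cst 0) [set v | v \in Lfun cube_measure p%:E /\ weak_derivative b u v].

Definition gradnorm p (k : nat) u : R :=
  \sum_(b : bmultinom N k.+1 | mdeg b == k) Lpnorm p (wderive p b u).

Definition pfun (P : mpoly N R) : 'rV[R]_N -> R := fun x => meval (x 0) P.

(* [msize P] is the degree of P plus one. *)
Definition poly_le (r : nat) : set (mpoly N R) := [set P | (msize P <= r.+1)%N].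

Definition low_part (k : nat) (P : mpoly N R) : mpoly N R :=
  \sum_(d < k.+1) pihomog mdeg d P.

Definition poly_dist (r : nat) p u (P : mpoly N R) : R :=
  \sum_(i < r.+1) gradnorm p i (u \- pfun P).

Definition best_approx (r : nat) p u (P : mpoly N R) :=
  poly_le r P /\
  forall P', poly_le r P' -> poly_dist r p u P <= poly_dist r p u P'.

(* Pi is an admissible map u |-> Pi_{r,r,p} u; when p = 1 the minimizer need
   not be unique and Pi picks any one. *)
Definition projection (r : nat) p (Pi : ('rV[R]_N -> R) -> mpoly N R) :=
  forall u, sobolev r.+1 p u -> best_approx r p u (Pi u).

Section Theta.
Variables (p : R) (Pi : ('rV[R]_N -> R) -> mpoly N R).

Definition Pi_low (k : nat) u := low_part k (Pi u).
Definition Pi_co (k : nat) u := Pi u - Pi_low k u.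

Definition Tset (alpha : R) (k : nat) (A : set ('rV[R]_N -> R)) :
    set ('rV[R]_N -> R) :=
  [set u | [/\ A u,
    alpha * Lpnorm p (pfun (Pi_co k u)) <= Lpnorm p (pfun (Pi_low k u)) &
    Lpnorm p (u \- pfun (Pi u)) <= 2^-1 * Lpnorm p (pfun (Pi u))]].

(* Theta^alpha_{m,k,p}(A), where Pi stands for Pi_{m-1,m-1,p}. *)
Definition Theta (alpha : R) (m k : nat) (A : set ('rV[R]_N -> R)) : \bar R :=
  Order.min
    (ereal_inf
      [set (gradnorm p m u `^ p / Lpnorm p (pfun (Pi_low k u)) `^ p)%:E
        | u in Tset alpha k A `&`
               [set u | ~ {ae cube_measure, forall x, u x = 0}]])
    1%:E.

End Theta.

End cube.

(* Main.v *)
Require Import Defs.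
From HB Require Import structures.
From mathcomp Require Import all_boot all_order all_algebra.
From mathcomp.multinomials Require Import -(notations) mpoly.
From mathcomp Require Import all_classical all_reals all_analysis.
From mathcomp Require Import measurable_realfun ring lra.
Set Implicit Arguments.
Unset Strict Implicit.
Unset Printing Implicit Defensive.
Import Order.TTheory GRing.Theory Num.Theory.
Import numFieldNormedType.Exports.
Local Open Scope classical_set_scope.
Local Open Scope ring_scope.

(** Write [P] for the best polynomial approximation of [u] of degree at most
    [m - 1], and [P = a + l + h] with [a] its constant term, [l] its linear part
    and [h] the terms of degree at least two. For [u] admissible at the order 1
    with [alpha >= 16], the norm of [h] is at most a sixteenth of the norm [M] of
    [a + l]. Take [alpha' = 1/16].

    If the norm of [a] is at least a sixteenth of the norm of [l + h], then [u] is
    admissible at the order 0, and [M] is at most a constant times the norm of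
    [a]: the two ratios differ by a constant factor at most. Otherwise [l]
    dominates. A linear function is odd on a symmetric cube, so its negative part
    carries at least half of its norm ([Lpnorm_odd]); but [u >= 0], hence [u - P]
    is at least this negative part up to [a] and [h] ([linear_part_le]), and
    [M] is at most three times the norm of [u - P]. As this norm is at most a
    constant times the norm of the gradient of order [m] ([projection_error]), the
    ratio at [u] is bounded below by a constant, and the value at the order 0 is
    at most 1.

    What remains is the bound on [u - P], the Poincare inequality of order [m]
    ([sobolev_poincare]). It follows from the one of order one ([poincare1]) by
    downward induction on the order of differentiation ([jet_approx]): the
    derivatives of order [k] are close to constants, which are removed by
    subtracting monomials of degree [k], and this changes nothing in the higher
    orders.

    The inequality of order one comes from a representation of a function, minus
    an average, by bounded integral operators applied to its weak derivatives.
    Let [eta] be a bump of integral one. A bump [phi] minus its integral times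
    [eta] has integral zero, so its primitive is again a bump ([primitive_bump]).
    Replacing the factors of a product of bumps by multiples of [eta], one after
    the other, thus changes it by partial derivatives of products of bumps
    ([averaged_diff]); testing the weak derivatives against these and moving the
    primitives to the other side ([kernel_part_test]) gives the representation,
    tested against all products of bumps. These separate integrable functions
    ([fundamental_lemma]). The operators are bounded by Jensen's inequality
    ([Lpnorm_kaverage]), and both this bound and the transposition rest on one
    fact: exchanging some coordinates of two independent uniform points of the
    cube preserves their joint law ([swap_cubemE]). *)

(** * The uniform probability on the cube *)

Section cube_probability.
Variables (R : realType) (N : nat).

Definition cubem : set 'rV[R]_N -> \bar R := cube_measure R N.

HB.instance Definition _ := Measure.copy cubem (cube_measure R N).

Definition uitv : set R := [set` `]- 2^-1, 2^-1[].

Lemma measurable_uitv : measurable uitv.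
Proof. exact: measurable_itv. Qed.

Lemma cube_box : @cube R N = [set x | forall i, uitv (x 0 i)].
Proof.
by apply/seteqP; split=> x Cx i; have := Cx i; rewrite /uitv/= in_itv/= -ltr_norml.
Qed.

Lemma cubem_box (B : 'I_N -> set R) : (forall i, measurable (B i)) ->
  cubem [set x | forall i, B i (x 0 i)] =
  (\prod_(i < N) @lebesgue_measure R (B i `&` uitv))%E.
Proof.
move=> mB; rewrite /cubem /cube_measure/= /mrestr cube_box.
rewrite -(@lebesgue_row_box R N (fun i => B i `&` uitv)); last first.
  by move=> i; apply: measurableI => //; exact: measurable_uitv.
congr (lebesgue_row R N _); apply/seteqP; split => [x [Bx Ux] i|x BUx]; first by split.
by split => i; have [] := BUx i.
Qed.

Lemma lebesgue_uitv : @lebesgue_measure R uitv = 1%E.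
Proof.
rewrite /uitv lebesgue_measure_itv/= lte_fin gtrN// ?invr_gt0//.
by rewrite -EFinD opprK [in RHS](splitr 1) div1r.
Qed.

Lemma cubem_setT : cubem setT = 1%E.
Proof.
have -> : [set: 'rV[R]_N] = [set x | forall i : 'I_N, setT (x 0 i)] by apply/seteqP.
by rewrite (@cubem_box (fun=> setT))// big1// => i _; rewrite setTI lebesgue_uitv.
Qed.

HB.instance Definition _ := Measure_isProbability.Build _ _ _ cubem cubem_setT.

(** Extended real endpoints let one coordinate be constrained alone, and make
    the whole space a ray box. *)
Definition raybox (b : 'I_N -> \bar R) : set 'rV[R]_N :=
  [set x | forall i, ((x 0 i)%:E < b i)%E].

Lemma measurable_box (B : 'I_N -> set R) : (forall i, measurable (B i)) ->
  measurable [set x : 'rV[R]_N | forall i, B i (x 0 i)].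
Proof.
move=> mB.
have -> : [set x : 'rV[R]_N | forall i, B i (x 0 i)] =
    \big[setI/setT]_(i < N) ((fun x : 'rV[R]_N => x 0 i) @^-1` (B i)).
  apply/seteqP; split => [x Cx|x]; first by rewrite -bigcap_seq => i _; exact: Cx.
  by rewrite -bigcap_seq => Cx i; apply: (Cx i); rewrite /= mem_index_enum.
apply: bigsetI_measurable => i _; rewrite -[X in measurable X]setTI.
exact: measurable_coord.
Qed.

Definition ray (b : \bar R) : set R := [set t | (t%:E < b)%E].

Lemma measurable_ray b : measurable (ray b).
Proof.
case: b => [r||].
- have -> : ray r%:E = [set` `]-oo, r[].
    by apply/seteqP; split => t; rewrite /ray/= in_itv/= lte_fin.
  exact: measurable_itv.
- have -> : ray +oo%E = setT by apply/seteqP; split => // t _; rewrite /ray/= ltry.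
  exact: measurableT.
- have -> : ray -oo%E = set0 by apply/seteqP; split => // t; rewrite /ray/= ltNge leNye.
  exact: measurable0.
Qed.

Lemma measurable_raybox b : measurable (raybox b).
Proof. by apply: (@measurable_box (fun i => ray (b i))) => i; exact: measurable_ray. Qed.

Lemma raybox_setT : raybox (fun=> +oo%E) = setT.
Proof. by apply/seteqP; split => // x _ i; rewrite ltry. Qed.

(** The ray boxes form a pi-system generating the sigma-algebra, whose
    generators [x 0 i \in B] reduce to the case where [B] is a ray. *)
Lemma raybox_measure_unique (m1 m2 : {measure set 'rV[R]_N -> \bar R}) :
  (forall b, m1 (raybox b) = m2 (raybox b)) -> (m1 setT < +oo)%E ->
  forall A, measurable A -> m1 A = m2 A.
Proof.
move=> m12 m1T A mA; pose G := range raybox.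
apply: (@g_sigma_algebra_measure_unique _ _ _ G _ (fun=> setT)) => //.
- by move=> _ [b _ <-]; exact: measurable_raybox.
- by move=> _; exists (fun=> +oo%E) => //; exact: raybox_setT.
- by apply/seteqP; split => // x _; exists 0%N.
- move=> _ _ [b _ <-] [c _ <-]; exists (fun i => Order.min (b i) (c i)) => //.
  apply/seteqP; split => x; rewrite /raybox/=.
    by move=> h; split => i; have := h i; rewrite lt_min => /andP[].
  by move=> [h1 h2] i; rewrite lt_min h1 h2.
- by move=> _ [b _ <-].
- move: A mA; apply: smallest_sub; first exact: smallest_sigma_algebra.
  move=> _ [i [B [mB ->]]].
  have : (measurable_realfun.RGenInftyO.G (R:=R)).-sigma.-measurable B.
    by rewrite -measurable_realfun.RGenInftyO.measurableE.
  pose C := [set B : set R | <<s G >> ((fun x : 'rV[R]_N => x 0 i) @^-1` B)].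
  suff : <<s measurable_realfun.RGenInftyO.G (R:=R) >> `<=` C by exact.
  apply: smallest_sub.
    split.
    - by rewrite /C/= preimage_set0; exact: sigma_algebra0.
    - move=> D CD; rewrite /C/= (_ : _ @^-1` _ = [set: 'rV[R]_N] `\` ((fun x : 'rV[R]_N => x 0 i) @^-1` D)).
        exact: sigma_algebraCD.
      by apply/seteqP; split => x [].
    - by move=> F CF; rewrite /C/= preimage_bigcup; exact: sigma_algebra_bigcup.
  move=> _ [x ->]; apply: sub_sigma_algebra.
  exists (fun j => if j == i then x%:E else +oo%E) => //.
  apply/seteqP; split => y; rewrite /raybox/= in_itv/=.
    by move=> /(_ i); rewrite eqxx lte_fin.
  by move=> yx j; case: eqP => [->|_]; rewrite ?lte_fin ?ltry.
Qed.

End cube_probability.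
Arguments cubem {R N}.
Arguments uitv {R}.

(** * Exchanging coordinates of two independent points *)

Section swap.
Variables (R : realType) (N : nat).
Implicit Types (S : pred 'I_N) (x y : 'rV[R]_N).

(** Freezing one ray box leaves two finite measures of the other factor, so the
    uniqueness on one factor applies twice. *)
Lemma raybox2_measure_unique
    (m1 m2 : {measure set ('rV[R]_N * 'rV[R]_N) -> \bar R}) :
  (forall b c, m1 (raybox b `*` raybox c) = m2 (raybox b `*` raybox c)) ->
  (m1 setT < +oo)%E ->
  forall A B, measurable A -> measurable B -> m1 (A `*` B) = m2 (A `*` B).
Proof.
move=> m12 m1T.
have fst_uniq B : measurable B ->
    (forall b, m1 (raybox b `*` B) = m2 (raybox b `*` B)) ->
    forall A, measurable A -> m1 (A `*` B) = m2 (A `*` B).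
  move=> mB h A mA.
  have mTB : measurable ([set: 'rV[R]_N] `*` B) by exact: measurableX.
  pose P (m : {measure set ('rV[R]_N * 'rV[R]_N) -> \bar R}) :=
    measure_function_pushforward__canonical__measure_function_Measure
      (mrestr m mTB) (@measurable_fst _ _ 'rV[R]_N 'rV[R]_N).
  have PE (m : {measure set ('rV[R]_N * 'rV[R]_N) -> \bar R}) C : P m C = m (C `*` B).
    rewrite /P/= /pushforward /mrestr/=; congr (m _).
    by apply/seteqP; split => [[a b] /= [? []]|[a b] /= []].
  rewrite -!PE; apply: raybox_measure_unique => //.
    by move=> b; rewrite !PE.
  by rewrite PE (le_lt_trans _ m1T)// le_measure// inE//; exact: measurableX.
have snd_uniq A : measurable A ->
    (forall b, m1 (A `*` raybox b) = m2 (A `*` raybox b)) ->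
    forall B, measurable B -> m1 (A `*` B) = m2 (A `*` B).
  move=> mA h B mB.
  have mAT : measurable (A `*` [set: 'rV[R]_N]) by exact: measurableX.
  pose P (m : {measure set ('rV[R]_N * 'rV[R]_N) -> \bar R}) :=
    measure_function_pushforward__canonical__measure_function_Measure
      (mrestr m mAT) (@measurable_snd _ _ 'rV[R]_N 'rV[R]_N).
  have PE (m : {measure set ('rV[R]_N * 'rV[R]_N) -> \bar R}) C : P m C = m (A `*` C).
    rewrite /P/= /pushforward /mrestr/=; congr (m _).
    by apply/seteqP; split => [[a b] /= [? []]|[a b] /= []].
  rewrite -!PE; apply: raybox_measure_unique => //.
    by move=> b; rewrite !PE.
  by rewrite PE (le_lt_trans _ m1T)// le_measure// inE//; exact: measurableX.
move=> A B mA mB; apply: fst_uniq => // b.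
by apply: snd_uniq => //; exact: measurable_raybox.
Qed.

(** Integrating out the coordinates of [x] in [S] is integrating
    [f (mix S x y)] over an independent point [y] of the whole cube, which avoids
    splitting the space into two blocks of coordinates. *)
Definition mix S x y : 'rV[R]_N := \row_i (if S i then y 0 i else x 0 i).

Definition swap S (z : 'rV[R]_N * 'rV[R]_N) := (mix S z.1 z.2, mix S z.2 z.1).

Lemma measurable_mix S :
  measurable_fun setT (fun z : 'rV[R]_N * 'rV[R]_N => mix S z.1 z.2).
Proof.
apply: measurable_fun_row => i; under eq_fun do rewrite mxE.
case: (S i).
  exact: (measurableT_comp (measurable_coord i) measurable_snd).
exact: (measurableT_comp (measurable_coord i) measurable_fst).
Qed.

Lemma measurable_swap S : measurable_fun setT (swap S).
Proof.
apply: measurable_fun_pair; first exact: measurable_mix.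
exact: (measurableT_comp (measurable_mix S) (@measurable_swap _ _ _ _)).
Qed.

Lemma mix_swap S x y : mix S (mix S x y) (mix S y x) = x.
Proof. by apply/rowP => i; rewrite !mxE; case: (S i). Qed.

Definition swap_cubem S : {measure set ('rV[R]_N * 'rV[R]_N) -> \bar R} :=
  measure_function_pushforward__canonical__measure_function_Measure
    (@cubem R N \x @cubem R N)%E (measurable_swap S).

(** Exchanging coordinates of two independent points preserves the product of
    the two box volumes, factor by factor. *)
Lemma swap_cubemE S A : measurable A ->
  swap_cubem S A = (@cubem R N \x @cubem R N)%E A.
Proof.
move=> mA; apply/esym; apply: product_measure_unique => //.
move=> {A mA} A B mA mB; rewrite -product_measure1E//.
apply: raybox2_measure_unique => //; last first.
  rewrite /= /pushforward preimage_setT -setXTT product_measure1E//.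
  change (@cubem R N setT * @cubem R N setT < +oo)%E.
  by rewrite !cubem_setT mule1 ltry.
move=> b c; rewrite [RHS]product_measure1E; [|exact: measurable_raybox..].
transitivity ((@cubem R N \x @cubem R N)%E (swap S @^-1` (raybox b `*` raybox c))) => //.
pose b' i := if S i then c i else b i.
pose c' i := if S i then b i else c i.
have -> : swap S @^-1` (raybox b `*` raybox c) = raybox b' `*` raybox c'.
  apply/seteqP; rewrite /raybox/b'/c'; split => [[x y]|[x y]] /= [h1 h2].
    by split => i; have := h1 i; have := h2 i; rewrite !mxE; case: ifP.
  by split => i; have := h1 i; have := h2 i; rewrite !mxE; case: ifP.
rewrite [LHS]product_measure1E; [|exact: measurable_raybox..].
have rayE (d : 'I_N -> \bar R) : cubem (raybox d) =
    (\prod_(i < N) @lebesgue_measure R (ray (d i) `&` @uitv R))%E.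
  by apply: (@cubem_box _ _ (fun i => ray (d i))) => i; exact: measurable_ray.
change (@cubem R N (raybox b') * @cubem R N (raybox c') =
  @cubem R N (raybox b) * @cubem R N (raybox c))%E.
rewrite !rayE -!big_split/=; apply: eq_bigr => i _.
by rewrite /b' /c'; case: (S i) => //; rewrite muleC.
Qed.

Lemma ge0_integral_swap S (F : 'rV[R]_N * 'rV[R]_N -> \bar R) :
  measurable_fun [set: 'rV[R]_N * 'rV[R]_N] F -> (forall z, 0 <= F z)%E ->
  (\int[cubem \x cubem]_z F (swap S z) = \int[cubem \x cubem]_z F z)%E.
Proof.
move=> mF F0; transitivity (\int[swap_cubem S]_z F z)%E.
  by rewrite ge0_integral_pushforward//; exact: measurable_swap.
by apply: eq_measure_integral => A mA _; exact: swap_cubemE.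
Qed.

Lemma integrable_swap S (F : 'rV[R]_N * 'rV[R]_N -> \bar R) :
  (cubem \x cubem)%E.-integrable setT F ->
  (cubem \x cubem)%E.-integrable setT (F \o swap S).
Proof.
move=> /integrableP[mF iF]; apply/integrableP; split.
  exact: measurableT_comp (measurable_swap S).
rewrite (@ge0_integral_swap S (abse \o F))//.
exact: measurableT_comp.
by move=> z; exact: abse_ge0.
Qed.

Lemma integral_swap S (F : 'rV[R]_N * 'rV[R]_N -> \bar R) :
  (cubem \x cubem)%E.-integrable setT F ->
  (\int[cubem \x cubem]_z F (swap S z) = \int[cubem \x cubem]_z F z)%E.
Proof.
move=> iF; transitivity (\int[swap_cubem S]_z F z)%E.
  rewrite integral_pushforward//; [exact: measurable_swap| |exact: integrable_swap].
  by case/integrableP: iF.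
by apply: eq_measure_integral => A mA _; exact: swap_cubemE.
Qed.

Lemma ge0_integral_opp (F : 'rV[R]_N -> \bar R) :
  measurable_fun setT F -> (forall x, 0 <= F x)%E ->
  (\int[cubem]_x F (- x)%R = \int[cubem]_x F x)%E.
Proof.
have mN : measurable_fun setT (fun x : 'rV[R]_N => - x).
  apply: measurable_fun_row => i; under eq_fun do rewrite mxE.
  exact: measurableT_comp (measurable_coord i).
pose nu : {measure set 'rV[R]_N -> \bar R} :=
  measure_function_pushforward__canonical__measure_function_Measure
    (@cubem R N) mN.
move=> mF F0; transitivity (\int[nu]_x F x)%E.
  by rewrite ge0_integral_pushforward.
apply: eq_measure_integral => A mA _; apply: raybox_measure_unique => //; last first.
  by rewrite /nu/= /pushforward preimage_setT probability_setT ltry.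
move=> b; rewrite /nu/= /pushforward.
have mR i : measurable (-%R @^-1` ray (b i)).
  rewrite -[X in measurable X]setTI; apply: oppr_measurable => //; exact: measurable_ray.
have -> : (fun x : 'rV[R]_N => - x) @^-1` raybox b =
    [set x | forall i, (-%R @^-1` ray (b i)) (x 0 i)].
  by apply/seteqP; split => x h i; have := h i; rewrite /ray/= mxE.
etransitivity; first exact: (cubem_box mR).
apply/esym; etransitivity.
  by apply: (@cubem_box _ _ (fun i => ray (b i))) => i; exact: measurable_ray.
apply: eq_bigr => i _.
rewrite -lebesgue_measureN; last by apply: measurableI; [exact: measurable_ray|exact: measurable_uitv].
rewrite /pushforward; congr lebesgue_measure.
apply/seteqP; rewrite /uitv; split => t /= [Bt]; rewrite !in_itv/= => /andP[t1 t2].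
  by split => //; rewrite ltrNl t2 -ltrN2 t1.
by split => //; rewrite ltrN2 t2 ltrNl t1.
Qed.

End swap.

(** * Integrals of products of functions of one coordinate *)

Section product_integrals.
Variables (R : realType) (N : nat).
Local Notation T := 'rV[R]_N.

Lemma bounded_integrable d (X : measurableType d) (P : probability X R)
    (f : X -> R) (M : R) :
  measurable_fun setT f -> (forall x, `|f x| <= M) ->
  P.-integrable setT (EFin \o f).
Proof.
move=> mf fM; apply: (@le_integrable _ _ _ P _ _ _ (EFin \o cst M)) => //.
- exact/measurable_EFinP.
- by move=> x _ /=; rewrite lee_fin (le_trans (fM x))// ler_norm.
- exact: finite_measure_integrable_cst.
Qed.

Lemma mul_bounded_integrable d (X : measurableType d)
    (P : {measure set X -> \bar R}) (f g : X -> R) (M : R) :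
  P.-integrable setT (EFin \o f) -> measurable_fun setT g ->
  (forall x, `|g x| <= M) ->
  P.-integrable setT (EFin \o (fun x => f x * g x)).
Proof.
move=> fi mg gM; have [/measurable_EFinP mf _] := integrableP _ _ _ fi.
apply: (@le_integrable _ _ _ P _ _ _ (fun x => (M%:E * (f x)%:E)%E)) => //.
- by apply/measurable_EFinP; exact: measurable_funM.
- move=> x _; rewrite /= lee_fin !normrM mulrC ler_wpM2r//.
  by rewrite (le_trans (gM x))// ler_norm.
- exact: integrableZl.
Qed.

(** The inner integral is finite only almost everywhere, which is enough for
    replacing it by its real value under the outer one. *)
Lemma Rintegral_fubini1 (F : T * T -> R) :
  (cubem \x cubem)%E.-integrable setT (EFin \o F) ->
  \int[cubem]_x \int[cubem]_y F (x, y) = \int[(cubem \x cubem)%E]_z F z.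
Proof.
move=> iF; rewrite /Rintegral; congr fine.
rewrite -(integral12_prod_meas1 iF); apply: ae_eq_integral => //.
- apply/measurable_EFinP; apply: measurableT_comp; first exact: fine_measurable.
  exact: measurable_fubini_F iF.
- exact: measurable_fubini_F iF.
- have := integrable_ae measurableT (integrable_fubini_F iF).
  by apply: filterS => x /(_ I) h _ /=; rewrite fineK.
Qed.

Lemma Rintegral_swap S (F : T * T -> R) :
  (cubem \x cubem)%E.-integrable setT (EFin \o F) ->
  \int[cubem]_x \int[cubem]_y F (swap S (x, y)) =
  \int[cubem]_x \int[cubem]_y F (x, y).
Proof.
move=> iF; rewrite (Rintegral_fubini1 iF).
rewrite (@Rintegral_fubini1 (F \o swap S)); last first.
  exact: (@integrable_swap _ _ S (EFin \o F)).
by rewrite /Rintegral (integral_swap S iF).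
Qed.

(** Bounded and measurable: closed under products, and integrable against any
    finite measure. *)
Definition bmeas (f : R -> R) :=
  measurable_fun setT f /\ exists M : R, forall t, `|f t| <= M.

Definition prodfun (F : 'I_N -> R -> R) (x : T) : R := \prod_(l < N) F l (x 0 l).

Lemma measurable_prodfun_seq (s : seq 'I_N) F : (forall l, bmeas (F l)) ->
  measurable_fun setT (fun x : T => \prod_(l <- s) F l (x 0 l)).
Proof.
move=> bF; apply: measurable_prod => l _.
by apply: measurableT_comp; [exact: (bF l).1|exact: measurable_coord].
Qed.

Lemma bounded_prodfun_seq (s : seq 'I_N) F : (forall l, bmeas (F l)) ->
  exists M : R, forall x : T, `|\prod_(l <- s) F l (x 0 l)| <= M.
Proof.
move=> bF; have /choice[M FM] : forall l, exists M : R, forall t, `|F l t| <= M.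
  by move=> l; exact: (bF l).2.
exists (\prod_(l <- s) M l) => x; rewrite normr_prod.
by apply: ler_prod => l _; rewrite normr_ge0 FM.
Qed.

Lemma measurable_prodfun F : (forall l, bmeas (F l)) ->
  measurable_fun setT (prodfun F).
Proof. exact: measurable_prodfun_seq. Qed.

Lemma bounded_prodfun F : (forall l, bmeas (F l)) ->
  exists M : R, forall x : T, `|prodfun F x| <= M.
Proof. exact: bounded_prodfun_seq. Qed.

Definition uintegral (f : R -> R) : R := \int[@lebesgue_measure R]_(t in @uitv R) f t.

Lemma integral_coord k (f : R -> R) : bmeas f ->
  \int[@cubem R N]_x f (x 0 k) = uintegral f.
Proof.
move=> [mf [M fM]].
have mc : measurable_fun setT (fun x : T => x 0 k : measurableTypeR R).
  exact: measurable_coord.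
pose nu : {measure set (measurableTypeR R) -> \bar R} :=
  measure_function_pushforward__canonical__measure_function_Measure
    (@cubem R N) mc.
have nuE B : measurable B -> nu B = @lebesgue_measure R (B `&` @uitv R).
  move=> mB; rewrite /nu/= /pushforward.
  pose C l := if l == k then B else setT.
  have -> : (fun x : T => x 0 k) @^-1` B = [set x | forall i, C i (x 0 i)].
    apply/seteqP; split => [x Bx i|x /(_ k)]; rewrite /C ?eqxx//.
    by case: eqP => [->|].
  etransitivity; first by apply: cubem_box => i; rewrite /C; case: ifP.
  rewrite (bigD1 k)//= /C eqxx big1 ?mule1// => l /negPf ->.
  by rewrite setTI lebesgue_uitv.
have mU : measurable (@uitv R) by exact: measurable_uitv.
have iF : (@cubem R N).-integrable setT (EFin \o (fun x : T => f (x 0 k))).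
  apply: (@bounded_integrable _ _ _ _ M) => //.
  by apply: measurableT_comp => //; exact: measurable_coord.
rewrite /uintegral /Rintegral; congr fine.
transitivity (\int[nu]_t (f t)%:E)%E.
  rewrite integral_pushforward//.
  exact/measurable_EFinP.
rewrite (@negligible_integral _ (measurableTypeR R) R nu setT (~` @uitv R)
  (fun t => (f t)%:E))//; first last.
- by rewrite nuE ?setICl ?measure0//; exact: measurableC.
- apply/integrableP; split; first exact/measurable_EFinP.
  rewrite ge0_integral_pushforward//.
    by case/integrableP: iF.
  by apply/measurable_EFinP; exact: measurableT_comp.
- exact: measurableC.
rewrite setTD setCK; apply: eq_measure_integral => A mA Au.
by rewrite nuE// setIidl.
Qed.

(** Swapping the coordinate [k] of two independent points makes a function of
    this coordinate independent of the remaining factor. *)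
Lemma integral_split k (f : R -> R) (B : T -> R) M : bmeas f ->
  measurable_fun setT B -> (forall x, `|B x| <= M) ->
  (forall x y, B (mix (pred1 k) x y) = B x) ->
  \int[cubem]_x (f (x 0 k) * B x) = uintegral f * \int[cubem]_x B x.
Proof.
move=> bf mB BM Bk; have [mf [Mf fM]] := bf.
pose F (z : T * T) := f (z.1 0 k) * B z.2.
have mFf : measurable_fun setT (fun x : T => f (x 0 k)).
  by apply: measurableT_comp => //; exact: measurable_coord.
have mF : measurable_fun setT F.
  apply: measurable_funM; last exact: measurableT_comp.
  exact: (measurableT_comp mFf measurable_fst).
have iF : (@cubem R N \x @cubem R N)%E.-integrable setT (EFin \o F).
  apply: (@bounded_integrable _ _ (@cubem R N \x @cubem R N)%E _ (Mf * M)) => //.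
  by move=> z; rewrite normrM ler_pM.
have iB : (@cubem R N).-integrable setT (EFin \o B) by exact: bounded_integrable BM.
have ifk : (@cubem R N).-integrable setT (EFin \o (fun x => f (x 0 k))).
  by apply: (@bounded_integrable _ _ _ _ Mf).
have := Rintegral_swap (pred1 k) iF.
rewrite /F/=.
under [X in _ = X -> _]eq_Rintegral do rewrite RintegralZl//.
rewrite RintegralZr// integral_coord// => <-.
under [RHS]eq_Rintegral => x _ do under eq_Rintegral => y _ do rewrite Bk mxE/= eqxx.
rewrite Rintegral_cst//.
have -> : fine (@cubem R N setT) = 1 by rewrite cubem_setT.
by rewrite mulr1.
Qed.

Lemma integral_prodfun_seq (s : seq 'I_N) F : (forall l, bmeas (F l)) -> uniq s ->
  \int[@cubem R N]_x (\prod_(l <- s) F l (x 0 l)) = \prod_(l <- s) uintegral (F l).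
Proof.
move=> bF; elim: s => [_|k s IH /= /andP[ks us]].
  rewrite big_nil; under eq_Rintegral do rewrite big_nil.
  rewrite Rintegral_cst//.
  have -> : fine (@cubem R N setT) = 1 by rewrite cubem_setT.
  by rewrite mulr1.
under eq_Rintegral do rewrite big_cons.
rewrite big_cons -IH//.
have [M sM] := bounded_prodfun_seq s bF.
apply: (integral_split (M := M)) => //; first exact: measurable_prodfun_seq.
move=> x y; apply: eq_big_seq => l ls; rewrite mxE/=.
by case: eqP => // lk; move: ks; rewrite -lk ls.
Qed.

Lemma integral_prodfun F : (forall l, bmeas (F l)) ->
  \int[@cubem R N]_x prodfun F x = \prod_(l < N) uintegral (F l).
Proof. by move=> bF; apply: integral_prodfun_seq => //; exact: index_enum_uniq. Qed.

End product_integrals.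

(** * Smooth functions of one variable *)

Section smooth1.
Variable R : realType.
Implicit Types (f g : R -> R).

(** [n] times differentiable; the recursive form, differentiating first, makes
    the product and chain rules plain inductions. *)
Fixpoint diffn n f : Prop :=
  if n is n'.+1 then (forall x, derivable f x 1) /\ diffn n' (derive1 f) else True.

Definition smooth1 f := forall n, diffn n f.

Lemma diffnS n f : diffn n.+1 f -> diffn n f.
Proof. by elim: n f => //= n IH f [df [ddf dn]]; split => //; apply: IH; split. Qed.

Lemma smooth1_derivable f x : smooth1 f -> derivable f x 1.
Proof. by move=> sf; have [] := sf 1%N. Qed.

Lemma smooth1_derive f : smooth1 f -> smooth1 (derive1 f).
Proof. by move=> sf n; have [] := sf n.+1. Qed.

Lemma smooth1_continuous f : smooth1 f -> continuous f.
Proof.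
move=> sf x; apply: differentiable_continuous; apply/derivable1_diffP.
exact: smooth1_derivable.
Qed.

Lemma diffnD n f g : diffn n f -> diffn n g -> diffn n (f \+ g).
Proof.
elim: n f g => //= n IH f g [df dnf] [dg dng]; split.
  by move=> x; exact: derivableD.
rewrite (_ : derive1 _ = (derive1 f) \+ (derive1 g)); first exact: IH.
by apply/funext => x; rewrite /= !derive1E deriveD.
Qed.

Lemma diffnM n f g : diffn n f -> diffn n g -> diffn n (f \* g).
Proof.
elim: n f g => //= n IH f g df dg; split.
  by move=> x; apply: derivableM; [exact: df.1|exact: dg.1].
rewrite (_ : derive1 _ = ((derive1 f) \* g) \+ (f \* (derive1 g))).
  apply: diffnD; apply: IH; [exact: df.2|exact: (diffnS (n := n))|
    exact: (diffnS (n := n))|exact: dg.2].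
apply/funext => x; rewrite /= !derive1E deriveM; [|exact: df.1|exact: dg.1].
by rewrite addrC; congr (_ + _); exact: mulrC.
Qed.

Lemma diffn_cst n (c : R) : diffn n (cst c).
Proof.
elim: n c => //= n IH c; split => //.
have -> : derive1 (cst c) = cst (0 : R) :> (R -> R).
  by apply/funext => x; rewrite derive1_cst.
exact: IH.
Qed.

Lemma diffn_affine n f (s a : R) : diffn n f -> diffn n (fun x => f (s * x + a)).
Proof.
have da (x : R) : is_derive x 1 (fun x => s * x + a) s.
  by apply: is_derive_eq; rewrite addr0 [_ *: _]mulr1.
have dfa h x : derivable h (s * x + a) 1 ->
    is_derive x 1 (fun x => h (s * x + a)) (s * (derive1 h) (s * x + a)).
  move=> /derivableP dh; rewrite derive1E mulrC.
  exact: (@is_derive1_comp _ h (fun x => s * x + a) x _ _ dh (da x)).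
elim: n f => //= n IH f [df dnf]; split.
  by move=> x; have [] := dfa f x (df _).
rewrite (_ : derive1 _ = (cst s \* (fun x => (derive1 f) (s * x + a)))).
  by apply: diffnM; [exact: diffn_cst|exact: IH].
by apply/funext => x; rewrite derive1E; have [_ ->] := dfa f x (df _).
Qed.

Lemma diffn_id n : diffn n (@idfun R).
Proof.
case: n => //= n; split => //.
have -> : derive1 idfun = cst (1 : R) :> (R -> R).
  by apply/funext => x; rewrite derive1_id.
exact: diffn_cst.
Qed.

Lemma smooth1D f g : smooth1 f -> smooth1 g -> smooth1 (f \+ g).
Proof. by move=> sf sg n; exact: diffnD. Qed.

Lemma smooth1M f g : smooth1 f -> smooth1 g -> smooth1 (f \* g).
Proof. by move=> sf sg n; exact: diffnM. Qed.

Lemma smooth1_cst (c : R) : smooth1 (cst c).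
Proof. by move=> n; exact: diffn_cst. Qed.

Lemma smooth1_affine f (s a : R) : smooth1 f -> smooth1 (fun x => f (s * x + a)).
Proof. by move=> sf n; exact: diffn_affine. Qed.

Lemma smooth1X k : smooth1 (fun x : R => x ^+ k).
Proof.
elim: k => [|k IH].
  rewrite (_ : (fun _ => _) = cst 1); first exact: smooth1_cst.
  by apply/funext => x; rewrite expr0.
rewrite (_ : (fun _ => _) = (@idfun R \* (fun x => x ^+ k))).
  by apply: smooth1M => // n; exact: diffn_id.
by apply/funext => x; rewrite exprS.
Qed.

(** The classical flat functions [s ^ -k * exp (- c / s)] for [s > 0], extended
    by zero: their derivatives are combinations of functions of the same form. *)
Definition flat (c : R) (k : nat) (s : R) : R :=
  if 0 < s then s^-1 ^+ k * expR (- c * s^-1) else 0.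

(** Comparing [expR (c / s)] with one term of its power series, of order high
    enough to leave a factor [s ^ 2]: this is what makes [flat] differentiable
    at zero. *)
Lemma flat_le (c : R) k : 0 < c -> exists2 C, 0 < C & forall s, `|flat c k s| <= C * s ^+ 2.
Proof.
move=> c0; exists ((k.+2)`!%:R / c ^+ k.+2).
  by rewrite divr_gt0 ?exprn_gt0// ltr0n fact_gt0.
move=> s; rewrite /flat; case: ifPn => s0; last first.
  by rewrite normr0 mulr_ge0 ?sqr_ge0// divr_ge0// exprn_ge0// ltW.
rewrite ger0_norm; last by rewrite mulr_ge0 ?expR_ge0// exprn_ge0// invr_ge0 ltW.
have cs0 : 0 < c * s^-1 by rewrite mulr_gt0// invr_gt0.
have h : (c * s^-1) ^+ k.+2 / (k.+2)`!%:R <= expR (c * s^-1).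
  by rewrite (le_trans _ (expR_ge1Dxn k.+1 (ltW cs0)))// lerDr.
rewrite mulNr expRN ler_pdivrMr ?expR_gt0//.
rewrite (le_trans _ (ler_wpM2l _ h))//; last first.
  by rewrite mulr_ge0 ?sqr_ge0// divr_ge0// exprn_ge0// ltW.
have f0 : (k.+2)`!%:R != 0 :> R by rewrite pnatr_eq0 -lt0n fact_gt0.
have c1 : c ^+ k.+2 != 0 by rewrite expf_neq0// gt_eqF.
have s1 : s != 0 by rewrite gt_eqF.
rewrite exprMn [s^-1 ^+ k.+2]exprSr [s^-1 ^+ k.+1]exprSr.
move: (k.+2)`!%:R (c ^+ k.+2) (s^-1 ^+ k) f0 c1 => F X a F0 X0.
rewrite le_eqVlt; apply/orP; left; apply/eqP; field.
by rewrite F0 X0 s1.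
Qed.

Lemma flat_is_derive (c : R) k (x : R) : 0 < c ->
  is_derive x 1 (flat c k) (c * flat c k.+2 x - k%:R * flat c k.+1 x).
Proof.
move=> c0; have [x0|x0|->] := ltgtP x 0.
- have -> : c * flat c k.+2 x - k%:R * flat c k.+1 x = 0.
    by rewrite /flat ltNge (ltW x0)/= !mulr0 subr0.
  apply: (near_eq_is_derive (f := cst (0 : R^o))).
  near=> y; rewrite /flat ltNge ifN// negbK.
  by apply: ltW; near: y; exact: lt_nbhsl.
- have x1 : x != 0 by rewrite gt_eqF.
  apply: (@near_eq_is_derive _ R^o R^o (fun s : R => s^-1 ^+ k * expR (- c * s^-1))).
    near=> y; rewrite /flat ifT//.
    by near: y; exact: lt_nbhsr.
  have dV : is_derive x 1 (fun s : R => s^-1) (- x ^- 2).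
    by have := @is_deriveV _ id x 1 1 x1 (is_derive_id x 1); rewrite [_ *: _]mulr1.
  have dE : is_derive x 1 (fun s => expR (- c * s^-1)) (expR (- c * x^-1) * (- c * - x ^- 2)).
    have dZ : is_derive x 1 (fun s : R => - c * s^-1) (- c * - x ^- 2).
      exact: (@is_deriveZ _ R^o R^o (fun s : R => s^-1) (- c) x 1 (- x ^- 2) dV).
    exact: (@is_derive1_comp _ expR (fun s => - c * s^-1) x _ _ (is_derive_expR _) dZ).
  have dX : is_derive x 1 (fun s : R => s^-1 ^+ k) (k%:R * x^-1 ^+ k.-1 * - x ^- 2).
    have := @is_deriveX _ _ (fun s : R => s^-1) k x 1 _ dV.
    by rewrite exprfctE.
  have [dM vM] := is_deriveM dX dE.
  apply: DeriveDef; first exact: dM.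
  rewrite [LHS]vM /flat x0 /GRing.scale/=.
  move: (expR _) => e; rewrite -!exprVn; case: (k) => [|j].
    by rewrite expr0 !mul0r mul1r; ring.
  by rewrite /= !exprS -/(x^-1); ring.
- have -> : c * flat c k.+2 0 - k%:R * flat c k.+1 0 = 0.
    by rewrite /flat ltxx !mulr0 subr0.
  have [C C0 fC] := flat_le k c0.
  have cv : h^-1 *: (flat c k (h *: 1 + 0) - flat c k 0) @[h --> 0^'] --> (0 : R).
    apply/cvgr0Pnorm_lt => e e0.
    near=> h.
    rewrite /flat ltxx subr0 addr0 [_ *: 1]mulr1 -/(flat c k h).
    have h0 : h != 0 by near: h; exact: nbhs_dnbhs_neq.
    rewrite normrM normfV ltr_pdivrMl ?normr_gt0//.
    rewrite (le_lt_trans (fC h))// -(real_normK (num_real h)) expr2.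
    rewrite mulrA mulrC ltr_pM2l ?normr_gt0//.
    rewrite mulrC -ltr_pdivlMr//.
    near: h; apply: dnbhs0_lt.
    by rewrite divr_gt0.
  apply: DeriveDef; first by apply/cvg_ex; exists 0.
  exact: cvg_lim cv.
Unshelve. all: by end_near. Qed.

End smooth1.

(** * Bumps and their primitives *)

Section bump.
Variable R : realType.
Implicit Types (f g phi : R -> R).

Lemma smooth1_flat (c : R) k : 0 < c -> smooth1 (flat c k).
Proof.
move=> c0 n; elim: n k => //= n IH k; split.
  by move=> x; have [] := flat_is_derive k x c0.
have -> : derive1 (flat c k) =
    (cst c \* flat c k.+2) \+ (cst (- k%:R) \* flat c k.+1).
  apply/funext => x; have [_] := flat_is_derive k x c0.
  by rewrite derive1E => -> /=; rewrite mulNr.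
by apply: diffnD; apply: diffnM; do ?exact: diffn_cst; exact: IH.
Qed.

(** The radius of the support is kept away from the boundary, so that products
    of bumps have compact support inside the cube. *)
Definition bump phi := smooth1 phi /\
  exists r : R, [/\ 0 < r, r < 2^-1 & forall t, r < `|t| -> phi t = 0].

Lemma bumpM f phi : smooth1 f -> bump phi -> bump (f \* phi).
Proof.
move=> sf [sp [r [r0 r1 pr]]]; split; first exact: smooth1M.
by exists r; split => // t rt; rewrite /= pr// mulr0.
Qed.

Lemma bumpD f g : bump f -> bump g -> bump (f \+ g).
Proof.
move=> [sf [r [r0 r1 fr]]] [sg [s [s0 s1 gs]]]; split; first exact: smooth1D.
exists (Num.max r s); split; first by rewrite lt_max r0.
  by rewrite gt_max r1.
by move=> t; rewrite gt_max => /andP[rt st]; rewrite /= fr// gs// addr0.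
Qed.

Lemma bumpZ (c : R) f : bump f -> bump (fun t => c * f t).
Proof. by move=> bf; exact: (bumpM (smooth1_cst c) bf). Qed.

Lemma bumpB f g (c : R) : bump f -> bump g -> bump (fun t => f t - c * g t).
Proof.
move=> bf bg; have := bumpD bf (bumpZ (- c) bg).
by congr bump; apply/funext => t /=; rewrite mulNr.
Qed.

Lemma bump_derive phi : bump phi -> bump (derive1 phi).
Proof.
move=> [sp [r [r0 r1 pr]]]; split; first exact: smooth1_derive.
exists r; split => // t rt.
have nt : \forall s \near t, r < `|s|.
  have ct : `|s| @[s --> t] --> `|t| by exact: (@norm_continuous _ R t).
  exact: (cvgr_gt _ ct _ rt).
have h : \forall s \near t, cst 0 s = phi s.
  near=> s; rewrite pr//.
  by near: s.
rewrite derive1E -(near_eq_derive _ h); exact: derive_cst.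
Unshelve. all: by end_near. Qed.

Lemma bump_bmeas phi : bump phi -> bmeas phi.
Proof.
move=> [sp [r [r0 r1 pr]]]; have cp := smooth1_continuous sp.
split; first exact: continuous_measurable_fun.
have rr : - r <= r by rewrite ge0_cp ?ltW.
have cpr : {within `[- r, r], continuous (fun t => `|phi t|)}.
  apply: continuous_subspaceT => t.
  by apply: (continuous_comp (cp t)); exact: norm_continuous.
have [c _ cM] := EVT_max rr cpr.
exists `|phi c| => t; have [rt|tr] := ltP r `|t|; first by rewrite pr// normr0.
by apply: cM; rewrite in_itv/= -ler_norml.
Qed.

(** A smooth function positive exactly on [ ]a, b[ ], which tends to the
    indicator of this interval as [c] tends to zero. *)
Definition hat (a b c : R) (t : R) := flat c 0 (t - a) * flat c 0 (b - t).

Lemma flat_ge0 (c : R) k t : 0 <= flat c k t.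
Proof.
rewrite /flat; case: ifPn => // t0.
by rewrite mulr_ge0 ?expR_ge0// exprn_ge0// invr_ge0 ltW.
Qed.

Lemma flat_le1 (c : R) t : 0 < c -> flat c 0 t <= 1.
Proof.
move=> c0; rewrite /flat expr0 mul1r; case: ifPn => // t0.
by rewrite expR_le1 mulNr oppr_le0 mulr_ge0// ?invr_ge0 ltW.
Qed.

Lemma hat_ge0 a b c t : 0 <= hat a b c t.
Proof. by rewrite mulr_ge0 ?flat_ge0. Qed.

Lemma hat_le1 a b c t : 0 < c -> hat a b c t <= 1.
Proof. by move=> c0; rewrite mulr_ile1 ?flat_ge0 ?flat_le1. Qed.

Lemma hat_bump a b c : 0 < c -> - 2^-1 < a -> b < 2^-1 -> bump (hat a b c).
Proof.
move=> c0 a1 b1; split.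
  have -> : hat a b c = (fun t => flat c 0 (1 * t + - a)) \* (fun t => flat c 0 (-1 * t + b)).
    by apply/funext => t; rewrite /hat/= mul1r mulN1r [b - t]addrC.
  by apply: smooth1M; apply: smooth1_affine; exact: smooth1_flat.
(* [- a] and [b] bound the support, but can both be nonpositive when it is
   empty; the radius must be positive. *)
exists (Num.max 4^-1 (Num.max (- a) b)); split.
- by rewrite lt_max invr_gt0 ltr0n.
- rewrite !gt_max b1 andbT ltrNl a1 andbT; lra.
- move=> t; rewrite !gt_max => /and3P[_ at1 bt].
  rewrite /hat /flat !subr_gt0.
  have [t0|t0] := leP 0 t.
    by rewrite ger0_norm// in bt; rewrite [t < b]ltNge (ltW bt)/= mulr0.
  rewrite ltr0_norm// ltrN2 in at1.
  by rewrite [a < t]ltNge (ltW at1)/= mul0r.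
Qed.

Lemma bump_outside phi t : bump phi -> ~ uitv t -> phi t = 0.
Proof.
move=> [_ [r [r0 r1 pr]]] nt; apply: pr; rewrite ltNge; apply/negP => tr; apply: nt.
by rewrite /uitv/= in_itv/= -ltr_norml (le_lt_trans tr).
Qed.

Lemma bmeas_integrable_fin f (A : set R) : bmeas f -> measurable A ->
  (@lebesgue_measure R A < +oo)%E -> (@lebesgue_measure R).-integrable A (EFin \o f).
Proof.
move=> [mf [M fM]] mA Afin; apply: measurable_bounded_integrable => //.
- exact: measurable_funTS.
- by exists M; split; [exact: num_real|move=> N MN x _ /=; rewrite (le_trans (fM x))// ltW].
Qed.

Lemma bmeas_integrable f : bmeas f ->
  (@lebesgue_measure R).-integrable uitv (EFin \o f).
Proof.
move=> bf; apply: bmeas_integrable_fin => //; first exact: measurable_uitv.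
by rewrite lebesgue_uitv ltry.
Qed.

Lemma bmeas_cst (c : R) : bmeas (cst c : R -> R).
Proof. by split => //; exists `|c|. Qed.

Lemma bmeasM f g : bmeas f -> bmeas g -> bmeas (fun t => f t * g t).
Proof.
move=> [mf [M fM]] [mg [M' gM]]; split; first exact: measurable_funM.
by exists (M * M') => t; rewrite normrM ler_pM.
Qed.

Lemma bmeasD f g : bmeas f -> bmeas g -> bmeas (fun t => f t + g t).
Proof.
move=> [mf [M fM]] [mg [M' gM]]; split; first exact: measurable_funD.
by exists (M + M') => t; rewrite (le_trans (ler_normD _ _))// lerD.
Qed.

Lemma bmeas_le (s : R) : bmeas (fun t : R => (t <= s)%R%:R).
Proof.
split; last by exists 1 => t; case: (t <= s); rewrite ?normr1 ?normr0.
have -> : (fun t : R => (t <= s)%R%:R) = \1_([set` `]-oo, s]]) :> (R -> R).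
  by apply/funext => t; rewrite indicE; congr ((_ : bool)%:R);
    apply/idP/idP; rewrite ?inE/= ?in_itv.
exact: measurable_indic.
Qed.

Lemma uintegralZ (c : R) f : bmeas f -> uintegral (fun t => c * f t) = c * uintegral f.
Proof.
move=> bf; rewrite /uintegral RintegralZl//; first exact: measurable_uitv.
exact: bmeas_integrable.
Qed.

Lemma uintegralD f g : bmeas f -> bmeas g -> uintegral (fun t => f t + g t) = uintegral f + uintegral g.
Proof.
move=> bf bg; have mU := @measurable_uitv R.
by rewrite /uintegral RintegralD//; apply: bmeas_integrable.
Qed.

(** Written as an integral over the fixed interval, so that it is linear in
    [phi] and can be exchanged with products over the coordinates. *)
Definition primitive phi : R -> R := fun s => uintegral (fun t => phi t * (t <= s)%R%:R).

Lemma primitive_derive phi s : bump phi ->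
  derivable (primitive phi) s 1 /\ derive1 (primitive phi) s = phi s.
Proof.
move=> bp.
have mU := @measurable_uitv R; have [mp [M pM]] := bump_bmeas bp.
have iT : (@lebesgue_measure R).-integrable setT (EFin \o phi).
  have := (@integrable_mkcond _ (measurableTypeR R) R (@lebesgue_measure R) uitv
    (EFin \o phi) mU).1 (bmeas_integrable (bump_bmeas bp)).
  congr (_.-integrable _ _); apply/funext => t; rewrite /= patchE.
  case: ifPn => //; rewrite notin_setE => nt.
  by rewrite /= (bump_outside bp nt).
have -> : primitive phi = fun s => \int[@lebesgue_measure R]_(t in [set` `]-oo, s]]) phi t.
  apply/funext => u; rewrite /primitive /uintegral Rintegral_mkcond [RHS]Rintegral_mkcond.
  apply: eq_Rintegral => t _; rewrite !patchE.
  case: ifPn => [_|]; last first.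
    by rewrite notin_setE => nt; rewrite (bump_outside bp nt) if_same.
  by rewrite mem_setE in_itv/=; case: (t <= u); rewrite ?mulr1 ?mulr0.
apply: (@continuous_FTC1 _ _ _ _ (s + 1)) => //.
- by rewrite ltrDl.
- exact: integrableS iT.
- exact: ltNyr.
- by case: bp => sp _; exact: (@smooth1_continuous R phi sp s).
Qed.

(** The primitive is zero to the left of the support, and to the right of it
    because the total integral is zero. *)
Lemma primitive_bump phi : bump phi -> uintegral phi = 0 -> bump (primitive phi).
Proof.
move=> bp J0; have [sp [r [r0 r1 pr]]] := bp; split.
  case=> // n; split; first by move=> s; have [] := primitive_derive s bp.
  have -> : derive1 (primitive phi) = phi.
    by apply/funext => s; have [] := primitive_derive s bp.
  exact: sp.
exists r; split=> // s rs; have [s0|s0] := leP 0 s.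
  rewrite ger0_norm// in rs.
  rewrite -[RHS]J0 /primitive; congr uintegral; apply/funext => t.
  have [ts|st] := leP t s; first by rewrite mulr1.
  by rewrite pr ?mul0r// (lt_trans rs)// (lt_le_trans st)// ler_norm.
rewrite ltr0_norm// in rs.
have -> : primitive phi s = uintegral (cst 0).
  congr uintegral; apply/funext => t; have [ts|st] := leP t s; last by rewrite mulr0.
  by rewrite pr ?mul0r// (lt_le_trans rs)// -normrN (le_trans _ (ler_norm _))// lerN2.
by rewrite /uintegral/= Rintegral_cst ?mul0r//; exact: measurable_uitv.
Qed.

Lemma norm_uintegral_le f (M : R) : bmeas f -> (forall t, `|f t| <= M) -> `|uintegral f| <= M.
Proof.
move=> bf fM; have mU := @measurable_uitv R.
have ibf := bmeas_integrable bf.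
have h1 : `|uintegral f| <= uintegral (fun t => `|f t|) by exact: le_normr_Rintegral ibf.
have h2 : uintegral (fun t => `|f t|) <= uintegral (cst M).
  apply: le_Rintegral => //.
    apply: bmeas_integrable; split; first by apply: measurableT_comp => //; exact: bf.1.
    by exists M => t; rewrite normr_id.
  exact/bmeas_integrable/bmeas_cst.
have h3 : uintegral (cst M) = M by rewrite /uintegral/= Rintegral_cst//= lebesgue_uitv mulr1.
by rewrite (le_trans h1)// (le_trans h2)// h3.
Qed.

Lemma uintegral_derive phi : bump phi -> uintegral (derive1 phi) = 0.
Proof.
move=> bp; have [sp [r [r0 r1 pr]]] := bp.
have sd := smooth1_derive sp.
have cp := smooth1_continuous sp; have cd := smooth1_continuous sd.
have h2 : 0 < 2^-1 :> R by rewrite invr_gt0.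
have N2 : - 2^-1 < 2^-1 :> R by rewrite gtrN.
have bd := bump_bmeas (bump_derive bp).
rewrite /uintegral /uitv Rintegral_itv_bndo_bndc; last exact: bmeas_integrable.
rewrite Rintegral_itv_obnd_cbnd; last first.
  apply: bmeas_integrable_fin => //.
  by rewrite lebesgue_measure_itv/=; case: ifP => _; rewrite ?ltry// -EFinD ltry.
have p1 : phi 2^-1 = 0 by rewrite pr// gtr0_norm.
have p2 : phi (- 2^-1) = 0 by rewrite pr// normrN gtr0_norm.
rewrite /Rintegral (@continuous_FTC2 _ _ phi)//.
- by rewrite p1 p2 sube0.
- exact: continuous_subspaceT.
- split; first by move=> x _; exact: smooth1_derivable.
  + by apply: cvg_at_right_filter; exact: cp.
  + by apply: cvg_at_left_filter; exact: cp.
Qed.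

End bump.

Section density.
Context d (T : measurableType d) (R : realType).
Variables (mu : {measure set T -> \bar R}) (f : T -> \bar R).
Hypotheses (mf : measurable_fun setT f) (f0 : forall x, (0 <= f x)%E).

(** The two hypotheses are arguments so that the function, applied to their
    proofs, carries the structure of a measure. *)
Definition density (_ : measurable_fun setT f) (_ : forall x, (0 <= f x)%E)
  (A : set T) : \bar R := (\int[mu]_(t in A) f t)%E.

Let density0 : density mf f0 set0 = 0%E.
Proof. by rewrite /density integral_set0. Qed.

Let density_ge0 A : (0 <= density mf f0 A)%E.
Proof. by apply: integral_ge0. Qed.

Let density_sigma_additive : semi_sigma_additive (density mf f0).
Proof. exact: semi_sigma_additive_nng_induced. Qed.

HB.instance Definition _ := isMeasure.Build _ _ _ (density mf f0)
  density0 density_ge0 density_sigma_additive.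

End density.

(** * Products of bumps as test functions *)

Section product_bumps.
Variables (R : realType) (N : nat).
Local Notation T := 'rV[R]_N.
Implicit Types (F : 'I_N -> R -> R).

Definition bumps F := forall l, bump (F l).

Lemma bumps_bmeas F : bumps F -> forall l, bmeas (F l).
Proof. by move=> bF l; exact: bump_bmeas. Qed.

Definition dfactor (i : 'I_N) F : 'I_N -> R -> R :=
  fun l => if l == i then derive1 (F l) else F l.

Lemma bumps_dfactor i F : bumps F -> bumps (dfactor i F).
Proof. by move=> bF l; rewrite /dfactor; case: ifP => // _; exact: bump_derive. Qed.

Lemma prodfun_is_derive i F (x : T) : (forall l, smooth1 (F l)) ->
  is_derive x 'e_i (prodfun F) (prodfun (dfactor i F) x).
Proof.
move=> sF.
pose C := \prod_(l < N | l != i) F l (x 0 l).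
have prodE h : prodfun F (h *: 'e_i + x) = F i (h *: 1 + x 0 i) * C.
  rewrite /prodfun (bigD1 i)//= !mxE !eqxx mulr1; congr (_ * _).
    by rewrite [h *: 1]mulr1.
  apply: eq_bigr => l li; rewrite !mxE (negPf li) andbF mulr0 add0r//.
have prodE0 : prodfun F x = F i (x 0 i) * C by rewrite /prodfun (bigD1 i).
have cv : h^-1 *: (prodfun F (h *: 'e_i + x) - prodfun F x) @[h --> 0^'] -->
    prodfun (dfactor i F) x.
  have -> : prodfun (dfactor i F) x = derive1 (F i) (x 0 i) * C.
    rewrite /prodfun (bigD1 i)//= /dfactor eqxx; congr (_ * _).
    by apply: eq_bigr => l /negPf ->.
  have -> : (fun h => h^-1 *: (prodfun F (h *: 'e_i + x) - prodfun F x)) =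
     (fun h => (h^-1 *: (F i (h *: 1 + x 0 i) - F i (x 0 i))) * C).
    apply/funext => h; rewrite prodE prodE0 -mulrBl.
    exact: mulrA.
  apply: cvgM; last exact: cvg_cst.
  have /cvg_ex[l hl] := @smooth1_derivable R (F i) (x 0 i) (sF i).
  by rewrite derive1E /derive (cvg_lim _ hl).
apply: DeriveDef; first by apply/cvg_ex; eexists; exact: cv.
exact: cvg_lim cv.
Qed.

Lemma prodfun_continuous F : (forall l, smooth1 (F l)) -> continuous (prodfun F).
Proof.
move=> sF x; rewrite /prodfun.
elim: (index_enum _) => [|k s IH].
  rewrite (_ : (fun _ => _) = cst 1); first exact: cst_continuous.
  by apply/funext => y; rewrite big_nil.
rewrite (_ : (fun _ => _) = (fun y : T => F k (y 0 k) * \prod_(l <- s) F l (y 0 l))).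
  apply: continuousM => //.
  apply: (@continuous_comp _ _ _ (fun y : T => y 0 k) (F k)).
    exact: coord_continuous.
  exact: smooth1_continuous.
by apply/funext => y; rewrite big_cons.
Qed.

Lemma partial_prodfun i F : (forall l, smooth1 (F l)) ->
  partial i (prodfun F) = prodfun (dfactor i F).
Proof.
by move=> sF; apply/funext => x; have [_] := prodfun_is_derive i x sF.
Qed.

(** Iterated partial derivatives stay products of bumps, and the closed box of
    the radii contains the support. *)
Lemma prodfun_test F : bumps F -> test_function (prodfun F).
Proof.
move=> bF.
have /choice[r rP] : forall l, exists r : R, [/\ 0 < r, r < 2^-1 & forall t, r < `|t| -> F l t = 0].
  by move=> l; have [_] := bF l.
pose K := [set x : T | forall l, [set` `[- r l, r l]] (x ord0 l)].
have cK : compact K.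
  apply: (@rV_compact R N (fun l => [set` `[- r l, r l]])) => l.
  exact: segment_compact.
have clK : closed K by apply: compact_closed => //; exact: norm_hausdorff.
have sK : closure [set x | prodfun F x != 0] `<=` K.
  have KE : K = closure K by apply/closure_id.
  apply: (@subset_trans _ (closure K)); last by rewrite -KE.
  apply: closureS => x /= Fx l.
  rewrite /= in_itv/= -ler_norml leNgt; apply/negP => rx.
  by move: Fx; rewrite /prodfun (bigD1 l)//=; have [_ _ ->//] := rP l; rewrite mul0r eqxx.
split.
- move=> s; have : exists2 G, bumps G & foldr (@partial R N) (prodfun F) s = prodfun G.
    elim: s => [|i s [G bG /= ->]]; first by exists F.
    exists (dfactor i G); first exact: bumps_dfactor.
    by apply: partial_prodfun => l; have [] := bG l.
  move=> [G bG ->]; have sG l : smooth1 (G l) by have [] := bG l.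
  split; first exact: prodfun_continuous.
  by move=> i x; have [] := prodfun_is_derive i x sG.
- by apply: subclosed_compact sK => //; exact: closed_closure.
- apply: (subset_trans sK) => x Kx l.
  have := Kx l; rewrite /= in_itv/= -ler_norml => /le_lt_trans; apply.
  by have [] := rP l.
Qed.

End product_bumps.

(** * The fundamental lemma of the calculus of variations *)

Section fundamental_lemma.
Variables (R : realType) (N : nat).
Local Notation T := 'rV[R]_N.

(** Both endpoints move inwards, keeping the support inside the open interval,
    while the sharpness [c] tends to zero: the limit is the indicator of the
    points of the unit interval below [b]. *)
Definition approx_hat (b : R) (n : nat) : R -> R :=
  hat (- 2^-1 + n.+1%:R^-1) (b - n.+1%:R^-1) n.+1%:R^-1.

Lemma approx_hat_bump b n : b <= 2^-1 -> bump (approx_hat b n).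
Proof.
have n0 : 0 < n.+1%:R^-1 :> R by rewrite invr_gt0 ltr0n.
move=> b2; apply: hat_bump => //; first by rewrite ltrDl.
by rewrite ltrBlDr (le_lt_trans b2)// ltrDl.
Qed.

Lemma flat_cvg1 (s : nat -> R) (l : R) : 0 < l -> s n @[n --> \oo] --> l ->
  flat n.+1%:R^-1 0 (s n) @[n --> \oo] --> (1 : R).
Proof.
move=> l0 sl.
have : expR (- n.+1%:R^-1 * (s n)^-1) @[n --> \oo] --> (1 : R).
  rewrite -[X in _ --> X](expR0 R); apply: continuous_cvg; first exact: continuous_expR.
  rewrite -[X in _ --> X](mul0r l^-1).
  apply: cvgM; last by apply: cvgV => //; rewrite gt_eqF.
  by rewrite -[X in _ --> X]oppr0; apply: cvgN; exact: cvg_harmonic.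
apply: cvg_trans; apply: near_eq_cvg; near=> n.
rewrite /flat ifT ?expr0 ?mul1r//.
by near: n; exact: (cvgr_gt _ sl _ l0).
Unshelve. all: by end_near. Qed.

Lemma approx_hat_cvg b t : uitv t -> approx_hat b n t @[n --> \oo] --> ((t < b)%R%:R : R).
Proof.
rewrite /uitv/= in_itv/= => /andP[t1 t2]; have [tb|bt] := ltP t b.
  rewrite -(mulr1 1%:R); apply: cvgM.
    apply: (@flat_cvg1 _ (t + 2^-1)); first by rewrite -ltrBlDr sub0r.
    rewrite -[X in _ --> X]subr0; under eq_fun do rewrite opprD opprK addrA.
    by apply: cvgB; [exact: cvg_cst|exact: cvg_harmonic].
  apply: (@flat_cvg1 _ (b - t)); first by rewrite subr_gt0.
  rewrite -[X in _ --> X]subr0; under eq_fun do rewrite addrAC.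
  by apply: cvgB; [exact: cvg_cst|exact: cvg_harmonic].
apply: cvg_near_cst; near=> n; rewrite /approx_hat /hat [flat _ _ (_ - _ - t)]/flat.
by rewrite ifN ?mulr0// -leNgt subr_le0 (le_trans _ bt)// lerBlDr lerDl invr_ge0.
Unshelve. all: by end_near. Qed.

Lemma ae_cube : {ae @cubem R N, forall x : T, forall i : 'I_N, uitv (x 0 i)}.
Proof.
have mU : measurable [set x : T | forall i, uitv (x 0 i)].
  by apply: (@measurable_box _ _ (fun=> uitv)) => i; exact: measurable_uitv.
exists (~` [set x : T | forall i, uitv (x 0 i)]); split => //.
  exact: measurableC.
have U1 : cubem [set x : T | forall i, uitv (x 0 i)] = 1%E.
  etransitivity.
    by apply: (@cubem_box _ _ (fun=> uitv)) => i; exact: measurable_uitv.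
  by rewrite big1// => i _; rewrite setIid lebesgue_uitv.
by rewrite probability_setC// [X in (_ - X)%E]U1 subee.
Qed.

(** Clamping the endpoints to the closed unit interval does not change the box
    within the cube; it makes them real, and at most [2^-1] as the hats
    require. *)
Lemma raybox_indic (b : 'I_N -> \bar R) : exists2 c : 'I_N -> R,
  (forall l, c l <= 2^-1) &
  forall x : T, (forall i, uitv (x 0 i)) ->
    \1_(raybox b) x = \prod_(l < N) (x 0 l < c l)%R%:R :> R.
Proof.
have N2 : - 2^-1 <= 2^-1 :> R by rewrite ge0_cp ?invr_ge0.
exists (fun l => fine (Order.max (- 2^-1)%:E (Order.min (b l) 2^-1%:E))).
  move=> l; case: (b l) => [r||] /=.
  - by rewrite -EFin_min -EFin_max/= ge_max ge_min lexx orbT andbT N2.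
  - by rewrite minye -EFin_max/= ge_max lexx andbT N2.
  - by rewrite minNye maxeNy/= N2.
move=> x Ux.
have E l : ((x 0 l)%:E < b l)%E =
   (x 0 l < fine (Order.max (- 2^-1)%:E (Order.min (b l) 2^-1%:E)))%R.
  have := Ux l; rewrite /uitv/= in_itv/= => /andP[x1 x2].
  case: (b l) => [r||] /=.
  - rewrite -EFin_min -EFin_max/= lt_max lt_min x2 andbT lte_fin.
    by rewrite [_ < - _]ltNge (ltW x1).
  - by rewrite minye -EFin_max/= ltry lt_max x2 orbT.
  - by rewrite minNye maxeNy/= !ltNge leNye (ltW x1).
rewrite indicE; case: (boolP (x \in raybox b)).
  rewrite inE => h; rewrite big1// => l _.
  by rewrite -E h.
rewrite notin_setE => /existsNP[l /negP nl].
by rewrite (bigD1 l)//= -E (negPf nl) mul0r.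
Qed.

(** Products of bumps separate integrable functions: they approximate the
    indicators of ray boxes, and those determine a finite measure. *)
Lemma fundamental_lemma (h : T -> R) :
  (@cubem R N).-integrable setT (EFin \o h) ->
  (forall F, bumps F -> \int[@cubem R N]_x (h x * prodfun F x) = 0) ->
  {ae @cubem R N, forall x, h x = 0}.
Proof.
move=> ih hF; have [/measurable_EFinP mh _] := integrableP _ _ _ ih.
have box0 b : (\int[@cubem R N]_(x in raybox b) (h x)%:E = 0)%E.
  have [c c2 cE] := raybox_indic b.
  pose G n := fun l => approx_hat (c l) n.
  have bG n : bumps (G n) by move=> l; exact: approx_hat_bump.
  have mG n : measurable_fun setT (prodfun (G n)).
    by apply: measurable_prodfun; exact: bumps_bmeas.
  have [] := @dominated_convergence _ _ _ (@cubem R N) setT measurableT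
    (fun n x => (h x * prodfun (G n) x)%:E)
    (fun x => (h x * \1_(raybox b) x)%:E) (fun x => `|h x|%:E).
  - by move=> n; apply/measurable_EFinP; exact: measurable_funM.
  - apply/measurable_EFinP; apply: measurable_funM => //.
    by apply: measurable_indic; exact: measurable_raybox.
  - apply: filterS ae_cube => x Ux _.
    apply: cvg_EFin; first exact: nearW.
    apply: cvgM; first exact: cvg_cst.
    rewrite cE// /prodfun.
    elim: (index_enum _) => [|k s IH].
      rewrite big_nil (_ : (fun _ => _) = cst 1); first exact: cvg_cst.
      by apply/funext => n; rewrite big_nil.
    rewrite big_cons (_ : (fun _ => _) = (fun n => G n k (x 0 k) * \prod_(l <- s) G n l (x 0 l))).
      by apply: cvgM => //; exact: approx_hat_cvg.
    by apply/funext => n; rewrite big_cons.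
  - exact: integrable_norm.
  - apply: nearW => x n _; rewrite lee_fin normrM ler_piMr//.
    rewrite /prodfun normr_prod prodr_ile1// => l _.
    by rewrite normr_ge0 ger0_norm ?hat_ge0// hat_le1.
  move=> ib _ cv.
  have : (\int[@cubem R N]_x (h x * \1_(raybox b) x)%:E = 0)%E.
    apply/esym; apply: (cvg_unique _ _ cv) => //.
    apply: cvg_near_cst; apply: nearW => n.
    rewrite -[LHS]fineK; first by congr (_%:E); exact: hF.
    apply: integrable_fin_num => //.
    have [M GM] := bounded_prodfun (bumps_bmeas (bG n)).
    exact: mul_bounded_integrable GM.
  move=> <-; rewrite integral_mkcond; apply: eq_integral => x _.
  by rewrite patchE indicE; case: ifP => _; rewrite ?mulr1 ?mulr0.
have mhp : measurable_fun setT (EFin \o h)^\+%E by apply: measurable_funepos; exact/measurable_EFinP.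
have mhn : measurable_fun setT (EFin \o h)^\-%E by apply: measurable_funeneg; exact/measurable_EFinP.
have ihp : (@cubem R N).-integrable setT (EFin \o h)^\+%E by exact: integrable_funepos.
have ihn : (@cubem R N).-integrable setT (EFin \o h)^\-%E by exact: integrable_funeneg.
pose m1 : {measure set T -> \bar R} := density (@cubem R N) mhp (@funepos_ge0 _ _ (EFin \o h)).
pose m2 : {measure set T -> \bar R} := density (@cubem R N) mhn (@funeneg_ge0 _ _ (EFin \o h)).
have m12 A : measurable A -> m1 A = m2 A.
  apply: raybox_measure_unique; last exact: integrable_lty.
  move=> b; have mb : measurable (raybox b) by exact: measurable_raybox.
  have fin g : (@cubem R N).-integrable setT g ->
      (\int[@cubem R N]_(x in raybox b) g x)%E \is a fin_num.
    by move=> ig; apply: integrable_fin_num => //; exact: integrableS ig.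
  have := box0 b; rewrite integralE => /eqP.
  by rewrite sube_eq ?add0e ?fin// => /eqP.
have := @integral_ae_eq _ _ _ (@cubem R N) setT measurableT (cst 0%E) _ ih (measurable_cst _).
case=> [E _ mE|].
  rewrite integral0 integralE [X in (X - _)%E](m12 E mE) subee//.
  by apply: integrable_fin_num => //; exact: integrableS ihn.
move=> Z [mZ Z0 hZ]; exists Z; split => // x /= hx; apply: hZ => /= /(_ I) [].
exact: hx.
Qed.

End fundamental_lemma.

Section unit_bump.
Variable R : realType.

(** If all bumps had zero integral, the constant 1 would be orthogonal to all
    bumps, against the fundamental lemma in dimension one. *)
Lemma unit_bump_exists : exists eta : R -> R, bump eta /\ uintegral eta = 1.
Proof.
have [[phi [bphi Jphi]]|nJ] := pselect (exists phi : R -> R, bump phi /\ uintegral phi != 0).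
  exists (fun t => (uintegral phi)^-1 * phi t); split; first exact: bumpZ.
  by rewrite uintegralZ ?mulVf//; exact: bump_bmeas.
have : {ae @cubem R 1, forall x : 'rV[R]_1, (fun=> 1 : R) x = 0}.
  apply: fundamental_lemma; first exact: finite_measure_integrable_cst.
  move=> F bF; under eq_Rintegral do rewrite mul1r.
  rewrite integral_prodfun ?big_ord1; last exact: bumps_bmeas.
  by apply/eqP/negPn/negP => J0; apply: nJ; exists (F ord0).
move=> [Z [mZ Z0 hZ]].
have ZT : Z = setT.
  by apply/seteqP; split => // x _; apply: hZ => /= /eqP; rewrite oner_eq0.
move: Z0; rewrite ZT => Z0.
have : @cubem R 1 setT = 1%E by exact: cubem_setT.
move: Z0 => -> /eqP; rewrite eqe eq_sym oner_eq0//.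
Qed.

End unit_bump.

(** * Representation of a function by its weak gradient *)

Section representation.
Variables (R : realType) (N : nat) (eta : R -> R).
Hypotheses (beta : bump eta) (Jeta : uintegral eta = 1).
Local Notation T := 'rV[R]_N.
Implicit Types (F : 'I_N -> R -> R) (phi : R -> R).

(** Since [eta] has integral one, the correction makes the integral zero, and the
    primitive a bump. *)
Definition corrected phi : R -> R := fun t => phi t - uintegral phi * eta t.

Lemma corrected_bump phi : bump phi -> bump (corrected phi).
Proof. by move=> bp; exact: bumpB. Qed.

Lemma uintegral_corrected phi : bump phi -> uintegral (corrected phi) = 0.
Proof.
move=> bp; rewrite /corrected.
under eq_fun do rewrite -mulNr.
rewrite uintegralD ?uintegralZ ?Jeta ?mulr1 ?subrr//; do ?exact: bump_bmeas.
exact/bump_bmeas/bumpZ.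
Qed.

(** The kernel of the operator that integrates the corrected function:
    [primitive (corrected phi) s] is the integral of [phi t * kappa t s]. *)
Definition kappa (t s : R) : R := (t <= s)%R%:R - primitive eta s.

Lemma bmeas_kappa s : bmeas (fun t => kappa t s).
Proof. by apply: bmeasD; [exact: bmeas_le|exact: bmeas_cst]. Qed.

Lemma primitive_corrected phi s : bump phi ->
  primitive (corrected phi) s = uintegral (fun t => phi t * kappa t s).
Proof.
move=> bp; have be := bump_bmeas beta; have bm := bump_bmeas bp.
have bl := @bmeas_le R s.
have be1 : bmeas (fun t => eta t * (t <= s)%R%:R) by exact: bmeasM.
have bp1 : bmeas (fun t => phi t * (t <= s)%R%:R) by exact: bmeasM.
rewrite /primitive /corrected /kappa.
have -> : (fun t => (phi t - uintegral phi * eta t) * (t <= s)%R%:R) =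
  (fun t => phi t * (t <= s)%R%:R + (- uintegral phi) * (eta t * (t <= s)%R%:R)).
  by apply/funext => t; ring.
have -> : (fun t => phi t * ((t <= s)%R%:R - primitive eta s)) =
  (fun t => phi t * (t <= s)%R%:R + (- primitive eta s) * phi t).
  by apply/funext => t; ring.
rewrite uintegralD//; last by apply: bmeasM => //; exact: bmeas_cst.
rewrite uintegralD//; last by apply: bmeasM => //; exact: bmeas_cst.
by rewrite !uintegralZ// !mulNr [primitive eta s * _]mulrC.
Qed.

Lemma primitive_eta_continuous : continuous (primitive eta).
Proof.
move=> s; apply: differentiable_continuous; apply/derivable1_diffP.
by have [] := primitive_derive s beta.
Qed.

Lemma kappa_bounded : exists2 M, 0 <= M & forall t s, `|kappa t s| <= M.
Proof.
have [me [M eM]] := bump_bmeas beta.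
have M0 : 0 <= M by rewrite (le_trans _ (eM 0)).
exists (1 + M); first by rewrite addr_ge0.
move=> t s; rewrite /kappa (le_trans (ler_normB _ _))// lerD//.
  by case: (t <= s); rewrite ?normr1 ?normr0.
apply: norm_uintegral_le; first by apply: bmeasM; [exact: bump_bmeas|exact: bmeas_le].
move=> u; rewrite normrM (le_trans _ (eM u))// ler_piMr//.
by case: (u <= s); rewrite ?normr1 ?normr0.
Qed.

(** As [j] grows, the factors of [F] are replaced one by one by multiples of
    [eta], going from [prodfun F] to a multiple of [prodfun (fun=> eta)]. *)
Definition averaged (j : nat) F : 'I_N -> R -> R :=
  fun l => if (l < j)%N then (fun t => uintegral (F l) * eta t) else F l.

(** The difference of two consecutive averages is the partial derivative in the
    direction [j] of a product of bumps, the one defined here. *)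
Definition potential (j : 'I_N) F : 'I_N -> R -> R :=
  fun l => if l == j then primitive (corrected (F l)) else averaged j F l.

Lemma averaged_bumps j F : bumps F -> bumps (averaged j F).
Proof. by move=> bF l; rewrite /averaged; case: ifP => // _; exact: bumpZ. Qed.

Lemma potential_bumps j F : bumps F -> bumps (potential j F).
Proof.
move=> bF l; rewrite /potential; case: ifP => _; last exact: averaged_bumps.
by apply: primitive_bump; [exact: corrected_bump|exact: uintegral_corrected].
Qed.

Lemma averaged_diff (j : 'I_N) F x : bumps F ->
  prodfun (averaged j F) x - prodfun (averaged j.+1 F) x =
  prodfun (dfactor j (potential j F)) x.
Proof.
move=> bF; rewrite /prodfun (bigD1 j)//= [X in _ - X](bigD1 j)//= [RHS](bigD1 j)//=.
have -> : \prod_(i < N | i != j) averaged j.+1 F i (x 0 i) =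
          \prod_(i < N | i != j) averaged j F i (x 0 i).
  by apply: eq_bigr => i ij; rewrite /averaged ltnS leq_eqVlt (inj_eq val_inj) (negPf ij).
have -> : \prod_(i < N | i != j) dfactor j (potential j F) i (x 0 i) =
          \prod_(i < N | i != j) averaged j F i (x 0 i).
  by apply: eq_bigr => i /negPf ij; rewrite /dfactor /potential ij.
rewrite -mulrBl; congr (_ * _).
rewrite /dfactor eqxx /averaged ltnn ltnSn /potential eqxx.
have -> // : derive1 (primitive (corrected (F j))) = corrected (F j).
by apply/funext => s; have [] := primitive_derive s (corrected_bump (bF j)).
Qed.

(** The weak derivative in the direction [i], tested against products of bumps
    only: they suffice to determine it, and integrals against them factor. *)
Definition weak_partial (i : 'I_N) (f g : T -> R) := forall F, bumps F ->
  \int[@cubem R N]_x (f x * prodfun (dfactor i F) x) =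
  - \int[@cubem R N]_x (g x * prodfun F x).

Lemma integrable_mul_prodfun (f : T -> R) F :
  (@cubem R N).-integrable setT (EFin \o f) -> (forall l, bmeas (F l)) ->
  (@cubem R N).-integrable setT (EFin \o (fun x => f x * prodfun F x)).
Proof.
move=> fi bF; have [M FM] := bounded_prodfun bF.
by apply: mul_bounded_integrable FM => //; exact: measurable_prodfun.
Qed.

(** Summing the differences of consecutive averages; each one is a partial
    derivative, which the weak derivative of [f] transfers to [g]. *)
Lemma weak_partial_representation (f : T -> R) (g : 'I_N -> T -> R) F :
  (@cubem R N).-integrable setT (EFin \o f) ->
  (forall i, weak_partial i f (g i)) -> bumps F ->
  \int[@cubem R N]_x (f x * prodfun F x) =
  (\int[@cubem R N]_x (f x * prodfun (fun=> eta) x)) * \int[@cubem R N]_x prodfun F x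
  - \sum_(j < N) \int[@cubem R N]_x (g j x * prodfun (potential j F) x).
Proof.
move=> fi wfg bF.
pose I j := \int[@cubem R N]_x (f x * prodfun (averaged j F) x).
have ia j : (@cubem R N).-integrable setT (EFin \o (fun x => f x * prodfun (averaged j F) x)).
  by apply: integrable_mul_prodfun => //; apply: bumps_bmeas; exact: averaged_bumps.
have step (j : 'I_N) : \int[@cubem R N]_x (g j x * prodfun (potential j F) x) = I j.+1 - I j.
  have := wfg j _ (potential_bumps j bF); move/(congr1 -%R); rewrite opprK => <-.
  rewrite /I -[RHS]opprB; congr (- _).
  rewrite -RintegralB//; apply: eq_Rintegral => x _.
  by rewrite -mulrBr averaged_diff.
under eq_bigr do rewrite step.
rewrite -(big_mkord xpredT (fun j => I j.+1 - I j)) telescope_sumr//.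
have -> : I 0%N = \int[@cubem R N]_x (f x * prodfun F x).
  by apply: eq_Rintegral => x _.
have -> : I N = (\int[@cubem R N]_x (f x * prodfun (fun=> eta) x)) * \int[@cubem R N]_x prodfun F x.
  rewrite integral_prodfun; last exact: bumps_bmeas.
  rewrite mulrC -RintegralZl//; last first.
    by apply: integrable_mul_prodfun => // l; exact: bump_bmeas.
  apply: eq_Rintegral => x _; rewrite mulrCA; congr (_ * _).
  by rewrite /prodfun -big_split; apply: eq_bigr => l _; rewrite /averaged ltn_ord.
by rewrite opprB addrCA subrr addr0.
Qed.

(** The kernel through which the weak derivative in the direction [j] enters [f]
    minus its [eta]-average: the coordinates before [j] are averaged by [eta],
    the coordinate [j] is integrated. *)
Definition poincare_kernel (j : 'I_N) (x y : T) : R :=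
  (\prod_(l < N | (l < j)%N) eta (y 0 l)) * kappa (x 0 j) (y 0 j).

Definition upto (j : 'I_N) : pred 'I_N := fun l => (l <= j)%N.

(** The factors of [potential j F] before [j] and at [j] are integrals over one
    coordinate of [F], and the integral of a product of functions of distinct
    coordinates is the product of the integrals. *)
Lemma potential_integral j F x : bumps F ->
  prodfun (potential j F) x =
  \int[@cubem R N]_y (poincare_kernel j y x * prodfun F (mix (upto j) x y)).
Proof.
move=> bF.
pose B (l : 'I_N) := if (l < j)%N then (fun t => eta (x 0 l) * F l t) else
  if l == j then (fun t => F l t * kappa t (x 0 l)) else cst (F l (x 0 l)).
have bB l : bmeas (B l).
  have bl := bump_bmeas (bF l).
  rewrite /B; case: ifP => _; first by apply: bmeasM => //; exact: bmeas_cst.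
  case: ifP => _; last exact: bmeas_cst.
  by apply: bmeasM => //; exact: bmeas_kappa.
transitivity (\int[@cubem R N]_y prodfun B y).
  rewrite integral_prodfun//; apply: eq_bigr => l _.
  rewrite /potential /averaged /B.
  have [->|lj] := eqVneq l j; first by rewrite ltnn primitive_corrected.
  case: ifP => _; first by rewrite mulrC uintegralZ//; exact: bump_bmeas.
  rewrite /uintegral/= Rintegral_cst.
    by rewrite [X in fine X]lebesgue_uitv mulr1.
  exact: measurable_uitv.
apply: eq_Rintegral => y _; rewrite /prodfun /poincare_kernel.
rewrite (bigD1 j)//= (bigID (fun l : 'I_N => (l < j)%N))/=.
rewrite [X in _ = _ * X](bigD1 j)//= [X in _ = _ * (_ * X)](bigID (fun l : 'I_N => (l < j)%N))/=.
have E1 : \prod_(i < N | (i != j) && (i < j)%N) B i (y 0 i) =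
   (\prod_(l < N | (l < j)%N) eta (x 0 l)) *
   \prod_(i < N | (i != j) && (i < j)%N) F i (mix (upto j) x y 0 i).
  have Hj (i : 'I_N) : (i != j) && (i < j)%N = (i < j)%N.
    by case: (ltnP i j) => ij; rewrite ?andbF// andbT neq_ltn ij.
  rewrite (eq_bigl _ _ Hj) [X in _ = _ * X](eq_bigl _ _ Hj) -big_split/=.
  by apply: eq_bigr => l lj; rewrite /B lj mxE /upto ltnW.
have E2 : \prod_(i < N | (i != j) && ~~ (i < j)%N) B i (y 0 i) =
   \prod_(i < N | (i != j) && ~~ (i < j)%N) F i (mix (upto j) x y 0 i).
  apply: eq_bigr => l /andP[lj nlj].
  rewrite /B (negPf nlj) (negPf lj) mxE /upto leq_eqVlt (inj_eq val_inj).
  by rewrite (negPf nlj) (negPf lj).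
have E3 : B j (y 0 j) = kappa (y 0 j) (x 0 j) * F j (mix (upto j) x y 0 j).
  by rewrite /B ltnn eqxx mxE /upto leqnn mulrC.
by rewrite E1 E2 E3; ring.
Qed.

End representation.

(** * The L^p norm on the cube *)

Section Lp_norms.
Variables (R : realType) (N : nat) (p : R).
Hypothesis p1 : 1 <= p.
Local Notation T := 'rV[R]_N.
Local Notation Lp := (Lfun (@cubem R N) p%:E).
Local Notation nm := (@Lpnorm R N p).
Implicit Types (f g h : T -> R).

Let p0 : 0 < p. Proof. exact: lt_le_trans p1. Qed.
Let pn0 : p != 0. Proof. by rewrite gt_eqF. Qed.

Lemma Lfun_measurable f : f \in Lp -> measurable_fun setT f.
Proof. by move=> /sub_Lfun_mfun; rewrite inE. Qed.

Lemma Lfun_finite f : f \in Lp -> ('N[@cubem R N]_(p%:E)[EFin \o f] < +oo)%E.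
Proof. by move=> /sub_Lfun_finLfun; rewrite inE. Qed.

Lemma Lfun_intro f : measurable_fun setT f ->
  ('N[@cubem R N]_(p%:E)[EFin \o f] < +oo)%E -> f \in Lp.
Proof. by move=> mf ff; rewrite inE; apply/andP; split; rewrite inE. Qed.

Lemma LpnormE f : f \in Lp -> (nm f)%:E = ('N[@cubem R N]_(p%:E)[EFin \o f])%E.
Proof.
by move=> fL; rewrite /Lpnorm fineK// ge0_fin_numE; [exact: Lfun_finite|exact: Lnorm_ge0].
Qed.

Lemma Lpnorm_ge0 f : 0 <= nm f.
Proof. by rewrite /Lpnorm fine_ge0// Lnorm_ge0. Qed.

Lemma Lfun_integrable1 f : f \in Lp -> (@cubem R N).-integrable setT (EFin \o f).
Proof.
move=> fL; apply/Lfun1_integrable; apply: (@Lfun_subset _ _ _ _ 1%E p%:E) fL => //.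
exact: fin_num_measure.
Qed.

Lemma LfunD f g : f \in Lp -> g \in Lp -> (f \+ g) \in Lp.
Proof. by move=> fL gL; exact: rpredD. Qed.

Lemma LpnormD f g : f \in Lp -> g \in Lp -> nm (f \+ g) <= nm f + nm g.
Proof.
move=> fL gL; rewrite -lee_fin EFinD !LpnormE ?LfunD//.
by apply: eminkowski => //; exact: Lfun_measurable.
Qed.

Lemma LfunN f : f \in Lp -> (\- f) \in Lp.
Proof. by move=> fL; exact: rpredNr. Qed.

Lemma LpnormN f : nm (\- f) = nm f.
Proof.
rewrite /Lpnorm (_ : EFin \o (\- f) = (\- (EFin \o f))%E)//; congr fine.
exact: oppe_Lnorm.
Qed.

Lemma LfunB f g : f \in Lp -> g \in Lp -> (f \- g) \in Lp.
Proof. by move=> fL gL; exact: (LfunD fL (LfunN gL)). Qed.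

Lemma LpnormB f g : f \in Lp -> g \in Lp -> nm (f \- g) <= nm f + nm g.
Proof. by move=> fL gL; rewrite -(LpnormN g); exact: (LpnormD fL (LfunN gL)). Qed.

(** A bound on the integrals of the [p]-th powers also shows that [f] is in the
    space, so that functions defined by integrals need no separate argument. *)
Lemma Lpnorm_le_pow f g (B : R) : 0 <= B -> measurable_fun setT f -> g \in Lp ->
  (\int[@cubem R N]_x (`|f x| `^ p)%:E <= (B `^ p)%:E * \int[@cubem R N]_x (`|g x| `^ p)%:E)%E ->
  f \in Lp /\ nm f <= B * nm g.
Proof.
move=> B0 mf gL fg.
have powE h : ('N[@cubem R N]_(p%:E)[EFin \o h] `^ p = \int[@cubem R N]_x (`|h x| `^ p)%:E)%E.
  by rewrite poweR_Lnorm.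
have fgp : ('N[@cubem R N]_(p%:E)[EFin \o f] `^ p <= ((B * nm g) `^ p)%:E)%E.
  rewrite powE (le_trans fg)// powRM ?Lpnorm_ge0// EFinM.
  by rewrite -[X in (_ <= _ * X)%E]poweR_EFin LpnormE// powE.
have le : ('N[@cubem R N]_(p%:E)[EFin \o f] <= (B * nm g)%:E)%E.
  have Bg0 : 0 <= B * nm g by rewrite mulr_ge0// Lpnorm_ge0.
  have := @gt0_ler_poweR R p^-1.
  move=> /(_ _ _ _ _ _ fgp); rewrite -!poweRrM mulfV//= poweRe1 ?Lnorm_ge0//.
  rewrite -powRrM mulfV// powRr1//.
  apply.
  - by rewrite invr_ge0 ltW.
  - by rewrite in_itv/= leey andbT poweR_ge0.
  - by rewrite in_itv/= leey andbT lee_fin powR_ge0.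
have fL : f \in Lp by apply: Lfun_intro => //; rewrite (le_lt_trans le)// ltry.
by split => //; rewrite -lee_fin LpnormE.
Qed.

Let mpow (g : T -> R) : measurable_fun setT g -> measurable_fun setT (fun x => (`|g x| `^ p)%:E).
Proof.
move=> mg; apply/measurable_EFinP; apply: (measurableT_comp (measurable_powR _)).
exact: measurableT_comp.
Qed.

Lemma Lpnorm_ae_le f g : measurable_fun setT f -> g \in Lp ->
  {ae @cubem R N, forall x, `|f x| <= `|g x|} -> f \in Lp /\ nm f <= nm g.
Proof.
move=> mf gL fg; rewrite -[nm g]mul1r; apply: Lpnorm_le_pow => //.
rewrite powR1 mul1e; apply: ae_ge0_le_integral => //.
- exact: mpow.
- by apply: mpow; exact: Lfun_measurable gL.
- apply: filterS fg => x fgx _; rewrite lee_fin.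
  by apply: ge0_ler_powR => //; rewrite ?nnegrE ?ltW.
Qed.

Lemma Lpnorm_ae_eq f g : measurable_fun setT f -> g \in Lp ->
  {ae @cubem R N, forall x, f x = g x} -> f \in Lp /\ nm f = nm g.
Proof.
move=> mf gL fg.
have [fL le1] : f \in Lp /\ nm f <= nm g.
  by apply: Lpnorm_ae_le => //; apply: filterS fg => x ->.
have [_ le2] : g \in Lp /\ nm g <= nm f.
  by apply: Lpnorm_ae_le => //; [exact: Lfun_measurable|apply: filterS fg => x ->].
by split => //; apply/eqP; rewrite eq_le le1.
Qed.

Lemma Lfun_bounded f (M : R) : measurable_fun setT f ->
  {ae @cubem R N, forall x, `|f x| <= M} -> f \in Lp.
Proof.
move=> mf fM; have [] := @Lpnorm_ae_le f (cst M) mf (Lfun_cst _ _ _) => //.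
by apply: filterS fM => x h; rewrite (le_trans h)// ler_norm.
Qed.

Lemma Lpnorm_cst (c : R) : nm (cst c) = `|c|.
Proof.
have h : ('N[@cubem R N]_(p%:E)[EFin \o cst c] = `|c|%:E)%E.
  rewrite unlock /Lnorm.
  have -> : (\int[@cubem R N]_x (`|(EFin \o cst c) x| `^ p) = (`|c| `^ p)%:E)%E.
    rewrite (eq_integral (cst (`|c| `^ p)%:E))// integral_cst//.
    by rewrite [X in (_ * X)%E]cubem_setT mule1.
  rewrite poweR_EFin -powRrM mulfV//.
  by rewrite powRr1.
by rewrite /Lpnorm; rewrite [X in fine X]h.
Qed.

Lemma Lpnorm_eq0 f : f \in Lp -> nm f = 0 -> {ae @cubem R N, forall x, f x = 0}.
Proof.
move=> fL f0; have := LpnormE fL; rewrite f0 => /esym h.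
have mf : measurable_fun setT (EFin \o f).
  by apply/measurable_EFinP; exact: Lfun_measurable.
have pp : (0 < p%:E :> \bar R)%E by rewrite lte_fin.
have := Lnorm_eq0_eq0 mf pp h.
by apply: filterS => x /(_ I) [].
Qed.

Lemma Lfun_scale_l (c : R) f : f \in Lp -> (fun x => c * f x) \in Lp.
Proof.
move=> fL; have -> : (fun x => c * f x) = c \o* f by apply/funext => x /=; rewrite mulrC.
exact: Lfun_scale.
Qed.

Lemma Lfun_sum (I : Type) (s : seq I) (P : pred I) (F : I -> T -> R) :
  (forall i, F i \in Lp) -> (fun x => \sum_(i <- s | P i) F i x) \in Lp.
Proof.
move=> FL; elim: s => [|i s IH].
  rewrite (_ : (fun _ => _) = cst 0); first exact: Lfun_cst.
  by apply/funext => x; rewrite big_nil.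
case Pi : (P i); last first.
  by rewrite (_ : (fun _ => _) = (fun x => \sum_(i <- s | P i) F i x))//;
    apply/funext => x; rewrite big_cons Pi.
rewrite (_ : (fun _ => _) = (F i \+ (fun x => \sum_(i <- s | P i) F i x))).
  exact: LfunD.
by apply/funext => x; rewrite big_cons Pi.
Qed.

Lemma Lpnorm_sum (I : Type) (s : seq I) (F : I -> T -> R) :
  (forall i, F i \in Lp) -> nm (fun x => \sum_(i <- s) F i x) <= \sum_(i <- s) nm (F i).
Proof.
move=> FL; elim: s => [|i s IH].
  rewrite big_nil (_ : (fun _ => _) = cst 0); first by rewrite Lpnorm_cst normr0.
  by apply/funext => x; rewrite big_nil.
rewrite big_cons (_ : (fun _ => _) = (F i \+ (fun x => \sum_(i <- s) F i x))).
  rewrite (le_trans (LpnormD _ _))// ?lerD//.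
  exact: (@Lfun_sum _ s xpredT).
by apply/funext => x; rewrite big_cons.
Qed.

(** Hoelder's inequality with the constant 1, which has norm 1. *)
Lemma Lnorm1_le f : measurable_fun setT f ->
  ('N[@cubem R N]_1[EFin \o f] <= 'N[@cubem R N]_(p%:E)[EFin \o f])%E.
Proof.
move=> mf; have := p1; rewrite le_eqVlt => /predU1P[<-//|lt1p].
pose q := (1 - p^-1)^-1.
have pi1 : 0 < 1 - p^-1 by rewrite subr_gt0 invf_lt1.
have q0 : 0 < q by rewrite invr_gt0.
have := @hoelder _ _ _ (@cubem R N) f (cst 1) p q mf (@measurable_cst _ _ _ _ _ _) p0 q0.
rewrite /q invrK subrKC => /(_ erefl).
have -> : (f \* cst 1) = f by apply/funext => x /=; rewrite mulr1.
have -> : ('N[@cubem R N]_q%:E[EFin \o cst 1%R] = 1)%E.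
  rewrite (_ : EFin \o _ = cst 1%E)// Lnorm_cst1.
  by rewrite [X in (X `^ _)%E]cubem_setT poweR1r.
by rewrite mule1.
Qed.

End Lp_norms.

Section kernel_average.
Variables (R : realType) (N : nat) (p : R).
Hypothesis p1 : 1 <= p.
Local Notation T := 'rV[R]_N.
Local Notation Lp := (Lfun (@cubem R N) p%:E).
Local Notation nm := (@Lpnorm R N p).

Let p0 : 0 < p. Proof. exact: lt_le_trans p1. Qed.
Let pn0 : p != 0. Proof. by rewrite gt_eqF. Qed.

Lemma integrable_fst (g : T -> R) : (@cubem R N).-integrable setT (EFin \o g) ->
  (@cubem R N \x @cubem R N)%E.-integrable setT (EFin \o (fun z : T * T => g z.1)).
Proof.
move=> ig; have [/measurable_EFinP mg gfin] := integrableP _ _ _ ig.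
have mg1 : measurable_fun setT (fun z : T * T => g z.1).
  exact: (measurableT_comp mg measurable_fst).
apply/integrable12ltyP; first exact/measurable_EFinP.
under eq_integral do rewrite /= integral_cst// [X in (_ * X)%E]cubem_setT mule1.
exact: gfin.
Qed.

Variables (S : pred 'I_N) (K : T * T -> R) (B : R).
Hypotheses (mK : measurable_fun setT K) (B0 : 0 <= B) (KB : forall z, `|K z| <= B).

(** Averages of this kind are bounded on the [L^p] space because [mix S x y] has
    the law of [x] when [x] and [y] are independent. *)
Definition kaverage (g : T -> R) : T -> R :=
  fun x => \int[@cubem R N]_y (g (mix S x y) * K (x, y)).

Lemma integrable_kaverage (g : T -> R) : (@cubem R N).-integrable setT (EFin \o g) ->
  (@cubem R N \x @cubem R N)%E.-integrable setT
    (EFin \o (fun z : T * T => g (mix S z.1 z.2) * K z)).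
Proof.
move=> ig; apply: mul_bounded_integrable KB => //.
exact: (integrable_swap S (integrable_fst ig)).
Qed.

Lemma measurable_kaverage (g : T -> R) : (@cubem R N).-integrable setT (EFin \o g) ->
  measurable_fun setT (kaverage g).
Proof.
move=> ig.
apply: (measurableT_comp (@fine_measurable R setT measurableT)
  (measurable_fubini_F (integrable_kaverage ig))).
Qed.

Let measurable_mixl (x : T) : measurable_fun setT (mix S x).
Proof.
exact: (measurableT_comp (@measurable_mix R N S) (measurable_pair1 x)).
Qed.

(** Jensen's inequality in [y], then Tonelli's theorem and the invariance under
    swapping coordinates, which turns [mix S x y] into [x]. *)
Lemma Lpnorm_kaverage g : g \in Lp ->
  kaverage g \in Lp /\ nm (kaverage g) <= B * nm g.
Proof.
move=> gL; have mg := Lfun_measurable gL.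
have ig := Lfun_integrable1 p1 gL.
apply: Lpnorm_le_pow => //; first exact: measurable_kaverage.
have mgp : measurable_fun setT (fun x => (`|g x| `^ p)%:E).
  apply/measurable_EFinP; apply: (measurableT_comp (measurable_powR _)).
  exact: measurableT_comp.
have mgmix x : measurable_fun setT (fun y => g (mix S x y)).
  exact: measurableT_comp.
have ptw x : ((`|kaverage g x| `^ p)%:E <=
    (B `^ p)%:E * \int[@cubem R N]_y (`|g (mix S x y)| `^ p)%:E)%E.
  pose I := (\int[@cubem R N]_y (g (mix S x y) * K (x, y))%:E)%E.
  have mKx : measurable_fun setT (fun y => K (x, y)).
    exact: (measurableT_comp mK (measurable_pair1 x)).
  have h1 : (`|kaverage g x|%:E <= `|I|)%E.
    by rewrite /kaverage /Rintegral -/I; case: I => [r||] //=; rewrite ?normr0 ?leey.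
  have h2 : (`|I| <= B%:E * 'N[@cubem R N]_1[EFin \o (fun y => g (mix S x y))])%E.
    rewrite Lnorm1 -ge0_integralZl//; last by do 2 apply: measurableT_comp => //.
    apply: (le_trans (le_abse_integral _ _ _)) => //.
      by apply/measurable_EFinP; exact: measurable_funM.
    apply: ge0_le_integral => //.
    - by do 2 apply: measurableT_comp => //; exact: measurable_funM.
    - by apply: measurable_funeM; do 2 apply: measurableT_comp => //.
    - by move=> y _; rewrite lee_fin normrM mulrC ler_wpM2r.
  have h3 := Lnorm1_le p1 (mgmix x).
  have h4 : (`|kaverage g x|%:E <=
      B%:E * 'N[@cubem R N]_p%:E[EFin \o (fun y => g (mix S x y))])%E.
    by rewrite (le_trans h1)// (le_trans h2)// lee_wpmul2l.
  rewrite -poweR_EFin.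
  have -> : (\int[@cubem R N]_y (`|g (mix S x y)| `^ p)%:E =
     'N[@cubem R N]_p%:E[EFin \o (fun y => g (mix S x y))] `^ p)%E by rewrite poweR_Lnorm.
  rewrite -[X in (_ <= X * _)%E]poweR_EFin -poweRM ?lee_fin ?Lnorm_ge0//.
  apply: gt0_ler_poweR => //.
  - exact: ltW.
  - by rewrite in_itv/= leey andbT lee_fin.
  - by rewrite in_itv/= leey andbT mule_ge0// Lnorm_ge0.
have mF : measurable_fun setT (fun z : T * T => (`|g (mix S z.1 z.2)| `^ p)%:E).
  exact: (measurableT_comp mgp (@measurable_mix R N S)).
apply: (@le_trans _ _ (\int[@cubem R N]_x ((B `^ p)%:E *
     \int[@cubem R N]_y (`|g (mix S x y)| `^ p)%:E))%E).
  apply: ge0_le_integral => //.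
  - apply/measurable_EFinP; apply: (measurableT_comp (measurable_powR _)).
    by apply: measurableT_comp => //; exact: measurable_kaverage.
  - apply: measurable_funeM.
    by apply: (@measurable_fun_fubini_tonelli_F _ _ _ _ _ (@cubem R N) (fun z => (`|g (mix S z.1 z.2)| `^ p)%:E)) => // z; rewrite lee_fin powR_ge0.
rewrite ge0_integralZl//; last 3 first.
- by apply: (@measurable_fun_fubini_tonelli_F _ _ _ _ _ (@cubem R N) (fun z => (`|g (mix S z.1 z.2)| `^ p)%:E)) => // z; rewrite lee_fin powR_ge0.
- by move=> x _; apply: integral_ge0 => y _; rewrite lee_fin powR_ge0.
- by rewrite lee_fin powR_ge0.
rewrite lee_wpmul2l ?lee_fin ?powR_ge0//.
rewrite -(@fubini_tonelli1 _ _ _ _ _ _ _ (fun z => (`|g (mix S z.1 z.2)| `^ p)%:E))//; try by move=> z; rewrite lee_fin powR_ge0.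
have m1 : measurable_fun setT (fun z : T * T => (`|g z.1| `^ p)%:E).
  exact: (measurableT_comp mgp measurable_fst).
rewrite (@ge0_integral_swap R N S (fun z => (`|g z.1| `^ p)%:E))//; try by move=> z; rewrite lee_fin powR_ge0.
rewrite (@fubini_tonelli1 _ _ _ _ _ _ _ (fun z => (`|g z.1| `^ p)%:E))//; try by move=> z; rewrite lee_fin powR_ge0.
rewrite /fubini_F/=.
under eq_integral do rewrite integral_cst// [X in (_ * X)%E]cubem_setT mule1.
by [].
Qed.

End kernel_average.

(** * The Poincare inequality *)

Section poincare.
Variables (R : realType) (N : nat) (p : R) (eta : R -> R).
Hypotheses (p1 : 1 <= p) (beta : bump eta) (Jeta : uintegral eta = 1).
Local Notation T := 'rV[R]_N.
Local Notation Lp := (Lfun (@cubem R N) p%:E).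
Local Notation nm := (@Lpnorm R N p).

Lemma poincare_kernel_bounded (j : 'I_N) :
  exists2 B, 0 <= B & forall x y : T, `|poincare_kernel eta j x y| <= B.
Proof.
have [M1 M10 kM] := kappa_bounded beta.
have [_ [M2 eM]] := bump_bmeas beta.
have M20 : 0 <= M2 by rewrite (le_trans _ (eM 0)).
exists (\prod_(l < N | (l < j)%N) M2 * M1).
  by rewrite mulr_ge0// prodr_ge0.
move=> x y; rewrite /poincare_kernel normrM ler_pM// normr_prod.
by apply: ler_prod => l _; rewrite normr_ge0 eM.
Qed.

Lemma measurable_poincare_kernel (j : 'I_N) :
  measurable_fun setT (fun z : T * T => poincare_kernel eta j z.1 z.2).
Proof.
have m1 (l : 'I_N) : measurable_fun setT (fun z : T * T => z.1 0 l).
  exact: (measurableT_comp (@measurable_coord _ R N l) measurable_fst).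
have m2 (l : 'I_N) : measurable_fun setT (fun z : T * T => z.2 0 l).
  exact: (measurableT_comp (@measurable_coord _ R N l) measurable_snd).
rewrite /poincare_kernel /kappa; apply: measurable_funM.
  have -> : (fun z : T * T => \prod_(l < N | (l < j)%N) eta (z.2 0 l)) =
      (fun z : T * T => \prod_(l < N) (if (l < j)%N then eta (z.2 0 l) else 1)).
    by apply/funext => z; rewrite big_mkcond.
  apply: measurable_prod => l _; case: (l < j)%N => //.
  by apply: measurableT_comp => //; exact: (bump_bmeas beta).1.
apply: measurable_funB.
  have -> : (fun z : T * T => (z.1 0 j <= z.2 0 j)%R%:R) =
     (\1_([set` `[0, +oo[] : set R) \o (fun z : T * T => z.2 0 j - z.1 0 j)) :> (_ -> R).
    apply/funext => z; rewrite /= indicE; congr ((_ : bool)%:R).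
    by apply/idP/idP; rewrite ?inE/= in_itv/= andbT subr_ge0.
  apply: measurableT_comp; last exact: measurable_funB.
  exact: measurable_indic.
apply: measurableT_comp => //; apply: continuous_measurable_fun.
exact: primitive_eta_continuous.
Qed.

Definition kernel_part (j : 'I_N) (g : T -> R) : T -> R :=
  kaverage (upto j) (fun z => poincare_kernel eta j z.1 z.2) g.

(** The kernel form of [potential] and a swap of the coordinates up to [j] move
    the operator from the test function to [g]. The kernel reads only swapped
    coordinates, so the swap exchanges its two arguments. *)
Lemma kernel_part_test j (g : T -> R) F : (@cubem R N).-integrable setT (EFin \o g) ->
  bumps F ->
  \int[@cubem R N]_x (g x * prodfun (potential eta j F) x) =
  \int[@cubem R N]_x (kernel_part j g x * prodfun F x).
Proof.
move=> ig bF.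
have [B B0 KB] := poincare_kernel_bounded j; have mK := measurable_poincare_kernel j.
have [M FM] := bounded_prodfun (bumps_bmeas bF).
have mF := measurable_prodfun (bumps_bmeas bF).
pose G (z : T * T) := g z.1 * (poincare_kernel eta j z.2 z.1 * prodfun F (mix (upto j) z.1 z.2)).
have iG : (@cubem R N \x @cubem R N)%E.-integrable setT (EFin \o G).
  apply: (mul_bounded_integrable (M := B * M)).
  - exact: integrable_fst.
  - apply: measurable_funM.
      exact: (measurableT_comp mK (@measurable_function.measurable_swap _ _ _ _)).
    exact: (measurableT_comp mF (@measurable_mix R N _)).
  - by move=> z; rewrite normrM ler_pM.
transitivity (\int[@cubem R N]_x \int[@cubem R N]_y G (x, y)).
  apply: eq_Rintegral => x _; rewrite potential_integral// /G/= RintegralZl//.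
  apply: (mul_bounded_integrable (M := M)) => //.
    apply: (@bounded_integrable _ _ _ _ _ B) => // y.
    exact: (measurableT_comp mK (measurable_pair2 x)).
  exact: (measurableT_comp mF (measurableT_comp (@measurable_mix R N _) (measurable_pair1 x))).
rewrite -(Rintegral_swap (upto j) iG).
pose H (z : T * T) := (g (mix (upto j) z.1 z.2) * poincare_kernel eta j z.1 z.2) * prodfun F z.1.
have GH x y : G (swap (upto j) (x, y)) = H (x, y).
  rewrite /G /H /swap/= mix_swap mulrA; congr (_ * _ * _).
  rewrite /poincare_kernel !mxE /upto leqnn; congr (_ * _).
  by apply: eq_bigr => l lj; rewrite mxE ltnW.
have iK := integrable_kaverage (upto j) mK (fun z => KB z.1 z.2) ig.
have mFf : measurable_fun setT (fun z : T * T => prodfun F z.1).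
  exact: (measurableT_comp mF measurable_fst).
have iH : (@cubem R N \x @cubem R N)%E.-integrable setT (EFin \o H).
  exact: (mul_bounded_integrable (M := M) iK mFf).
transitivity (\int[@cubem R N]_x \int[@cubem R N]_y H (x, y)).
  by apply: eq_Rintegral => x _; apply: eq_Rintegral => y _; exact: GH.
rewrite /Rintegral; congr fine; apply: ae_eq_integral => //.
- apply/measurable_EFinP.
  exact: (measurableT_comp (@fine_measurable R setT measurableT) (measurable_fubini_F iH)).
- apply/measurable_EFinP; apply: measurable_funM => //.
  exact: (measurable_kaverage (upto j) mK (fun z => KB z.1 z.2) ig).
- apply: filterS (ae_integrable1 iK) => x ix _; congr (_%:E).
  rewrite /kernel_part /kaverage -RintegralZr//.
Qed.

(** The constant is the [eta]-average of [f]: by the representation tested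
    against products of bumps and the fundamental lemma, [f] minus this average
    is minus the sum of the kernel averages of its partial derivatives. *)
Lemma poincare1 : exists2 C : R, 0 <= C &
  forall (f : T -> R) (g : 'I_N -> T -> R), f \in Lp -> (forall i, g i \in Lp) ->
    (forall i, weak_partial i f (g i)) ->
  exists c : R, nm (f \- cst c) <= C * \sum_(i < N) nm (g i).
Proof.
have /choice[B BP] : forall j : 'I_N, exists B, 0 <= B /\ forall x y : T, `|poincare_kernel eta j x y| <= B.
  by move=> j; have [B B0 KB] := poincare_kernel_bounded j; exists B.
have B0 j : 0 <= B j by have [] := BP j.
exists (\sum_(j < N) B j); first exact: sumr_ge0.
move=> f g fL gL wfg.
pose c := \int[@cubem R N]_x (f x * prodfun (fun=> eta) x).
exists c.
have hL j : kernel_part j (g j) \in Lp /\ nm (kernel_part j (g j)) <= B j * nm (g j).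
  by apply: Lpnorm_kaverage => //; [exact: measurable_poincare_kernel|move=> z; have [] := BP j].
pose s := fun x => \sum_(j < N) kernel_part j (g j) x.
have sL : s \in Lp by apply: Lfun_sum => // j; have [] := hL j.
have fcL : (f \- cst c) \in Lp by apply: LfunB => //; exact: Lfun_cst.
have iA := Lfun_integrable1 p1.
have zero : {ae @cubem R N, forall x, ((f \- cst c) \+ s) x = 0}.
  apply: fundamental_lemma; first by apply: iA; exact: LfunD.
  move=> F bF; have bmF := bumps_bmeas bF.
  have iF h : h \in Lp -> (@cubem R N).-integrable setT (EFin \o (fun x => h x * prodfun F x)).
    by move=> hLp; apply: integrable_mul_prodfun => //; exact: iA.
  transitivity (\int[@cubem R N]_x (f x * prodfun F x)
     - c * \int[@cubem R N]_x prodfun F x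
     + \sum_(j < N) \int[@cubem R N]_x (kernel_part j (g j) x * prodfun F x)).
    have sumE : \int[@cubem R N]_x (s x * prodfun F x) =
        \sum_(j < N) \int[@cubem R N]_x (kernel_part j (g j) x * prodfun F x).
      rewrite /s.
      elim: (index_enum _) => [|k r IH].
        rewrite big_nil; under eq_Rintegral do rewrite big_nil mul0r.
        by rewrite Rintegral_cst// mul0r.
      rewrite big_cons -IH -RintegralD//; [|by apply: iF; have [] := hL k|].
        by apply: eq_Rintegral => x _; rewrite big_cons mulrDl.
      by apply: iF; apply: Lfun_sum => // j; have [] := hL j.
    have [M FM] := bounded_prodfun bmF.
    have i1 : (@cubem R N).-integrable setT (EFin \o prodfun F).
      by apply: (@bounded_integrable _ _ _ _ _ M) => //; exact: measurable_prodfun.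
    rewrite -sumE -RintegralZl// -RintegralB//; first last.
    - by apply: (@iF (cst c)); exact: Lfun_cst.
    - exact: iF.
    rewrite -RintegralD//; first last.
    - exact: iF.
    - have := iF _ fcL; congr (_.-integrable _ _).
      by apply/funext => x /=; rewrite mulrBl.
    by apply: eq_Rintegral => x _ /=; ring.
  rewrite (weak_partial_representation beta Jeta (g := g))//; last exact: iA.
  under [X in _ + X]eq_bigr => j _ do rewrite -kernel_part_test ?iA//.
  by rewrite -/c; ring.
have [_ ->] : (f \- cst c) \in Lp /\ nm (f \- cst c) = nm (\- s).
  apply: Lpnorm_ae_eq => //; [exact: Lfun_measurable fcL|exact: LfunN|].
  by apply: filterS zero => x /= /eqP; rewrite addr_eq0 => /eqP.
rewrite LpnormN (le_trans (Lpnorm_sum p1 _ (fun j => (hL j).1)))//.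
rewrite mulr_sumr; apply: ler_sum => j _.
rewrite (le_trans (hL j).2)// ler_wpM2r ?Lpnorm_ge0//.
by rewrite (bigD1 j)//= lerDl sumr_ge0.
Qed.

End poincare.

(** * Weak derivatives of polynomials *)

Section polynomial_derivatives.
Variables (R : realType) (N : nat).
Local Notation T := 'rV[R]_N.
Implicit Types (F q : 'I_N -> R -> R) (P : mpoly N R) (a b : multinom N).

(** The integrals factor, and in the factor [i] the product of [q i] with a bump
    is a bump, whose derivative has integral zero. *)
Lemma weak_partial_prodfun i q : (forall l, smooth1 (q l)) ->
  weak_partial i (prodfun q) (prodfun (dfactor i q)).
Proof.
move=> sq F bF.
pose G l := q l \* F l.
have bG : bumps G by move=> l; exact: bumpM.
have prodM A B (x : T) : prodfun A x * prodfun B x = prodfun (fun l => A l \* B l) x.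
  by rewrite /prodfun -big_split.
have bmG A B : (forall l, smooth1 (A l)) -> bumps B -> bumps (fun l => A l \* B l).
  by move=> sA bB l; exact: bumpM.
have sdq l : smooth1 (dfactor i q l).
  by rewrite /dfactor; case: ifP => // _; exact: smooth1_derive.
under eq_Rintegral do rewrite prodM.
under [in RHS]eq_Rintegral do rewrite prodM.
rewrite !integral_prodfun; try by apply: bumps_bmeas; apply: bmG => //; exact: bumps_dfactor.
rewrite (bigD1 i)//= [in RHS](bigD1 i)//= -mulNr; congr (_ * _); last first.
  by apply: eq_bigr => l /negPf li; rewrite /dfactor li.
rewrite /dfactor eqxx.
have b1 : bump (q i \* derive1 (F i)) by apply: bumpM => //; exact: bump_derive.
have b2 : bump (derive1 (q i) \* F i) by apply: bumpM => //; exact: smooth1_derive.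
apply/eqP; rewrite -addr_eq0 -uintegralD; [|exact: bump_bmeas..].
rewrite -[X in _ == X](uintegral_derive (bG i)); apply/eqP; congr uintegral; apply/funext => t.
have dq : derivable (q i) t 1 by exact: smooth1_derivable.
have dF : derivable (F i) t 1 by apply: smooth1_derivable; have [] := bF i.
rewrite /G /= !derive1E deriveM//; congr (_ + _).
exact: mulrC.
Qed.

Lemma pfunXE a (x : T) : pfun (mpolyX R a) x = prodfun (fun l t => t ^+ a l) x.
Proof. by rewrite /pfun mevalX. Qed.

Lemma pfun_sum (I : Type) (s : seq I) (c : I -> R) (Q : I -> mpoly N R) (x : T) :
  pfun (\sum_(i <- s) c i *: Q i) x = \sum_(i <- s) c i * pfun (Q i) x.
Proof.
elim: s => [|i s IH]; first by rewrite !big_nil /pfun meval0.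
by rewrite !big_cons -IH /pfun mevalD mevalZ.
Qed.

Lemma ae_monomial_le1 a : {ae @cubem R N, forall x : T, `|pfun (mpolyX R a) x| <= 1}.
Proof.
apply: filterS (@ae_cube R N) => x Ux.
rewrite pfunXE /prodfun normr_prod prodr_ile1// => l _.
rewrite normr_ge0 normrX exprn_ile1//.
have := Ux l; rewrite /uitv/= in_itv/= -ltr_norml => /ltW h.
by rewrite (le_trans h)// invf_le1// ler1n.
Qed.

Lemma measurable_pfun P : measurable_fun setT (pfun P : T -> R).
Proof.
rewrite (mpolyE P) (_ : pfun _ = (fun x : T => \sum_(a <- msupp P) mcoeff a P * pfun (mpolyX R a) x)).
  apply: measurable_sum => a; apply: measurable_funM => //.
  rewrite (_ : pfun _ = prodfun (fun l t => t ^+ a l)); last by apply/funext => x; exact: pfunXE.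
  apply: measurable_prod => l _; apply: measurable_funX.
  exact: measurable_coord.
by apply/funext => x; exact: pfun_sum.
Qed.

Lemma pfun_Lfun P (p : R) : 1 <= p -> (pfun P : T -> R) \in Lfun (@cubem R N) p%:E.
Proof.
move=> p1; rewrite (mpolyE P) (_ : pfun _ = (fun x : T => \sum_(a <- msupp P) mcoeff a P * pfun (mpolyX R a) x)).
  apply: Lfun_sum => // a; apply: Lfun_scale_l => //.
  apply: (Lfun_bounded p1 (M := 1)); last exact: ae_monomial_le1.
  exact: measurable_pfun.
by apply/funext => x; exact: pfun_sum.
Qed.

Lemma pfunD P Q : pfun (P + Q) = pfun P \+ pfun Q :> (T -> R).
Proof. by apply/funext => x; rewrite /pfun mevalD. Qed.

Lemma pfunB P Q : pfun (P - Q) = pfun P \- pfun Q :> (T -> R).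
Proof. by apply/funext => x; rewrite /pfun mevalB. Qed.

Lemma pfun_integrable P : (@cubem R N).-integrable setT (EFin \o (pfun P : T -> R)).
Proof. exact: (Lfun_integrable1 (lexx 1)) (pfun_Lfun _ _). Qed.

Lemma weak_partialD i (f g f' g' : T -> R) :
  (@cubem R N).-integrable setT (EFin \o f) -> (@cubem R N).-integrable setT (EFin \o g) ->
  (@cubem R N).-integrable setT (EFin \o f') -> (@cubem R N).-integrable setT (EFin \o g') ->
  weak_partial i f f' -> weak_partial i g g' -> weak_partial i (f \+ g) (f' \+ g').
Proof.
move=> intf intg intf' intg' wf wg F bF.
have bm := bumps_bmeas bF; have bmd := bumps_bmeas (bumps_dfactor i bF).
rewrite (@eq_Rintegral _ _ _ _ _ (fun x => f x * prodfun (dfactor i F) x + g x * prodfun (dfactor i F) x)); last first.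
  by move=> x _; rewrite /= mulrDl.
rewrite RintegralD//; [|exact: integrable_mul_prodfun..].
rewrite wf// wg// -opprD -RintegralD//; [|exact: integrable_mul_prodfun..].
by congr (- _); apply: eq_Rintegral => x _; rewrite /= mulrDl.
Qed.

Lemma weak_partialZ i (c : R) (f f' : T -> R) :
  (@cubem R N).-integrable setT (EFin \o f) ->
  (@cubem R N).-integrable setT (EFin \o f') ->
  weak_partial i f f' -> weak_partial i (fun x => c * f x) (fun x => c * f' x).
Proof.
move=> intf intf' wf F bF.
have bm := bumps_bmeas bF; have bmd := bumps_bmeas (bumps_dfactor i bF).
under eq_Rintegral do rewrite -mulrA.
under [in RHS]eq_Rintegral do rewrite -mulrA.
rewrite !RintegralZl//; [|exact: integrable_mul_prodfun..].
by rewrite wf// mulrN.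
Qed.

Lemma weak_partial_pfun i P : weak_partial i (pfun P) (pfun (mderiv i P)).
Proof.
have mono a : weak_partial i (pfun (mpolyX R a)) (pfun (mderiv i (mpolyX R a))).
  have -> : pfun (mpolyX R a) = prodfun (fun l t => t ^+ a l) :> (T -> R).
    by apply/funext => x; exact: pfunXE.
  have -> : pfun (mderiv i (mpolyX R a)) =
      prodfun (dfactor i (fun l t => t ^+ a l)) :> (T -> R).
    apply/funext => x; rewrite mderivX /pfun mevalZ mevalX /prodfun.
    rewrite (bigD1 i)//= [in RHS](bigD1 i)//= mulrA; congr (_ * _).
      rewrite /dfactor eqxx mnmBE mnm1E eqxx subn1.
      by rewrite derive1E exp_derive [RHS]mulr1.
    apply: eq_bigr => l /negPf li; rewrite /dfactor li mnmBE mnm1E eq_sym li subn0//.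
  by apply: weak_partial_prodfun => l; exact: smooth1X.
rewrite [in X in weak_partial _ X _](mpolyE P) [in X in weak_partial _ _ X](mpolyE P).
elim: (msupp P) => [|a s IH].
  rewrite big_nil mderiv0 => F bF; rewrite /pfun.
  under eq_Rintegral do rewrite meval0 mul0r.
  under [in RHS]eq_Rintegral do rewrite meval0 mul0r.
  by rewrite Rintegral_cst// mul0r oppr0.
rewrite big_cons mderivD !pfunD.
apply: weak_partialD => //; try exact: pfun_integrable.
rewrite mderivZ.
have pZ c Q : pfun (c *: Q) = (fun x : T => c * pfun Q x).
  by apply/funext => x; rewrite /pfun mevalZ.
by rewrite !pZ; apply: weak_partialZ => //; exact: pfun_integrable.
Qed.

(** Some exponent of [b] exceeds the one of [a], as the sums of the exponents
    would otherwise force [a = b]. *)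
Lemma mderivm_monomial_eq0 a b : (mdeg a <= mdeg b)%N -> a != b ->
  mderivm b (mpolyX R a) = 0.
Proof.
move=> ab nab; rewrite mderivmX.
suff [i ai] : exists i, (a i < b i)%N.
  by rewrite (bigD1 i)//= ffact_small// mul0n scale0r.
apply/existsP; apply: contraNT nab => /existsPn h.
have hle i : (b i <= a i)%N by rewrite leqNgt h.
have : (\sum_i b i = \sum_i a i)%N.
  by apply/eqP; rewrite eqn_leq leq_sum// -!mdegE ab.
have [_ sE] := leqif_sum (P := xpredT) (fun (i : 'I_N) _ => leqif_eq (hle i)).
move/eqP; rewrite sE => /forallP e; apply/eqP/mnmP => i.
by have := e i; rewrite /= => /eqP.
Qed.

Lemma mderivm_monomial_self a : exists2 c : R, c != 0 &
  mderivm a (mpolyX R a) = mpolyC N c.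
Proof.
exists (\prod_(i < N) (a i) ^_ (a i))%:R.
  rewrite pnatr_eq0 -lt0n prodn_gt0// => i; by rewrite ffact_gt0.
rewrite mderivmX -mul_mpolyC.
have -> : mnm_sub a a = mnm0 by apply/mnmP => i; rewrite mnmBE mnm0E subnn.
by rewrite mpolyX0 mulr1.
Qed.

End polynomial_derivatives.

(** * Weak derivatives of higher order *)

Section sobolev_poincare.
Variables (R : realType) (N : nat) (p : R).
Hypothesis p1 : 1 <= p.
Local Notation T := 'rV[R]_N.
Local Notation Lp := (Lfun (@cubem R N) p%:E).
Local Notation nm := (@Lpnorm R N p).
Local Notation D1 := (fun f : R -> R => derive1 f).
Implicit Types (F : 'I_N -> R -> R) (P : mpoly N R) (b : multinom N) (u : T -> R).

Let sgn_neq0 n : (-1) ^+ n != 0 :> R. Proof. by rewrite signr_eq0. Qed.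

Definition multi_factor b F : 'I_N -> R -> R := fun l => iter (b l) D1 (F l).

Lemma bump_iter n (phi : R -> R) : bump phi -> bump (iter n D1 phi).
Proof. by move=> bp; elim: n => //= n IH; exact: bump_derive. Qed.

Lemma multi_factor_bumps b F : bumps F -> bumps (multi_factor b F).
Proof. by move=> bF l; exact: bump_iter. Qed.

Lemma iter_partial_prodfun i n F : bumps F ->
  iter n (partial i) (prodfun F) =
  prodfun (fun l => if l == i then iter n D1 (F l) else F l).
Proof.
move=> bF; elim: n => [|n IH] /=.
  by congr prodfun; apply/funext => l; rewrite if_same.
rewrite IH partial_prodfun; last first.
  by move=> l; case: ifP => _; [have [] := bump_iter n (bF l)|have [] := bF l].
congr prodfun; apply/funext => l; rewrite /dfactor.
by case: eqP.
Qed.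

Lemma mpartial_prodfun b F : bumps F ->
  mpartial b (prodfun F) = prodfun (multi_factor b F).
Proof.
move=> bF; rewrite /mpartial.
have : uniq (enum 'I_N) by exact: enum_uniq.
have -> : multi_factor b F =
    fun l => if l \in enum 'I_N then iter (b l) D1 (F l) else F l.
  by apply/funext => l; rewrite mem_enum.
elim: (enum 'I_N) => [|i s IH] //= /andP[ins us].
rewrite IH// iter_partial_prodfun; last first.
  by move=> l; case: ifP => // _; exact: bump_iter.
congr prodfun; apply/funext => l; rewrite inE.
by have [->|li] := eqVneq l i; rewrite //= (negPf ins).
Qed.

Lemma multi_factorD1 b i F :
  multi_factor b (dfactor i F) = multi_factor (mnm_add b (mnm1 i)) F.
Proof.
apply/funext => l; rewrite /multi_factor /dfactor mnmDE mnm1E eq_sym.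
by have [_|_] := eqVneq i l; rewrite ?addn0 // addn1 iterSr.
Qed.

(** Products of bumps are test functions and determine an integrable function;
    [w] is tested against them only, so that derivatives computed coordinate
    by coordinate qualify. *)
Lemma weak_derivative_norm_unique b u (v w : T -> R) : v \in Lp -> w \in Lp ->
  weak_derivative b u v ->
  (forall F, bumps F -> \int[@cubem R N]_x (u x * mpartial b (prodfun F) x) =
     (-1) ^+ mdeg b * \int[@cubem R N]_x (w x * prodfun F x)) ->
  nm v = nm w.
Proof.
move=> vL wL wv ww.
have iv := Lfun_integrable1 p1 vL; have iw := Lfun_integrable1 p1 wL.
have vw : {ae @cubem R N, forall x, (v \- w) x = 0}.
  apply: fundamental_lemma; first exact: (Lfun_integrable1 p1 (LfunB p1 vL wL)).
  move=> F bF; have bm := bumps_bmeas bF.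
  have := wv _ (prodfun_test bF); rewrite ww// => /(mulfI (sgn_neq0 _)) e.
  transitivity (\int[@cubem R N]_x (v x * prodfun F x) - \int[@cubem R N]_x (w x * prodfun F x)).
    rewrite -RintegralB//; [|exact: integrable_mul_prodfun..].
    by apply: eq_Rintegral => x _; rewrite /= mulrBl.
  by apply/eqP; rewrite subr_eq0; apply/eqP; rewrite e.
have [] // := Lpnorm_ae_eq p1 (Lfun_measurable vL) wL.
by apply: filterS vw => x /= /eqP; rewrite subr_eq0 => /eqP.
Qed.

Lemma wderive_spec m b u : sobolev m p u -> (mdeg b <= m)%N ->
  wderive p b u \in Lp /\ weak_derivative b u (wderive p b u).
Proof.
move=> [_ hu] bm; have [v vL vw] := hu b bm.
have Dv : [set v | v \in Lfun (cube_measure R N) p%:E /\ weak_derivative b u v] v by split.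
exact: (xgetPex (cst 0 : T -> R) (ex_intro _ v Dv)).
Qed.

Lemma mpartial0 (phi : T -> R) : mpartial (mnm0 (n := N)) phi = phi.
Proof.
rewrite /mpartial; elim: (enum _) => //= i s ->.
by rewrite mnm0E.
Qed.

Lemma wderive0_norm u : u \in Lp -> nm (wderive p (mnm0 (n := N)) u) = nm u.
Proof.
move=> uL.
have hu : weak_derivative (mnm0 (n := N)) u u.
  by move=> phi _; rewrite mpartial0 mdeg0 expr0 mul1r.
have [wL ww] : [set v | v \in Lfun (cube_measure R N) p%:E /\ weak_derivative (mnm0 (n := N)) u v]
    (wderive p (mnm0 (n := N)) u).
  by apply: (xgetPex (cst 0 : T -> R)); exists u.
apply: (weak_derivative_norm_unique wL uL ww) => F bF.
by rewrite mpartial0 mdeg0 expr0 mul1r.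
Qed.

(** Removing one direction of [b] at a time, by integration by parts in a single
    variable. *)
Lemma pfun_weak_derivative P b F : bumps F ->
  \int[@cubem R N]_x (pfun P x * mpartial b (prodfun F) x) =
  (-1) ^+ mdeg b * \int[@cubem R N]_x (pfun (mderivm b P) x * prodfun F x).
Proof.
move=> bF; rewrite mpartial_prodfun//.
have [n] := ubnP (mdeg b); elim: n b F bF => // n IH b F bF bn.
have [->|b0] := eqVneq b (mnm0 (n := N)).
  rewrite mdeg0 expr0 mul1r mderivm0m; apply: eq_Rintegral => x _.
  by congr (_ * prodfun _ _); apply/funext => l; rewrite /multi_factor mnm0E.
have [i bi] : exists i, (0 < b i)%N.
  apply/existsP; apply: contraNT b0 => /existsPn h; apply/eqP/mnmP => i.
  by rewrite mnm0E; apply/eqP; rewrite -leqn0 leqNgt.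
pose c := mnm_sub b (mnm1 i).
have bE : b = mnm_add c (mnm1 i).
  apply/mnmP => l; rewrite mnmDE mnmBE mnm1E.
  by have [<-|_] := eqVneq i l; rewrite ?subn0 ?addn0// subnK.
have dE : mdeg b = (mdeg c).+1 by rewrite bE mdegD mdeg1 addn1.
rewrite bE -multi_factorD1 IH; [|exact: bumps_dfactor|by rewrite -ltnS -dE].
rewrite -bE dE exprS bE mderivmDm mderivmU1m weak_partial_pfun//.
by rewrite mulN1r mulrN mulNr.
Qed.

Section jet.
Variables (m : nat) (u : T -> R).
Hypothesis su : sobolev m p u.

(** The [b]-th derivative of [u - P], as a difference of functions rather than as
    a chosen representative. *)
Definition defect P b : T -> R := wderive p b u \- pfun (mderivm b P).

Lemma defect_Lfun P b : (mdeg b <= m)%N -> defect P b \in Lp.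
Proof.
by move=> bm; apply: LfunB => //; [have [] := wderive_spec su bm|exact: pfun_Lfun].
Qed.

Lemma weak_partial_wderive b i : (mdeg b < m)%N ->
  weak_partial i (wderive p b u) (wderive p (mnm_add b (mnm1 i)) u).
Proof.
move=> bm F bF.
have dE : mdeg (mnm_add b (mnm1 i)) = (mdeg b).+1 by rewrite mdegD mdeg1 addn1.
have [_ w1] := wderive_spec su (ltnW bm).
have [_ w2] : wderive p (mnm_add b (mnm1 i)) u \in Lp /\
    weak_derivative (mnm_add b (mnm1 i)) u (wderive p (mnm_add b (mnm1 i)) u).
  by apply: (wderive_spec su); rewrite dE.
have := w1 _ (prodfun_test (bumps_dfactor i bF)).
rewrite mpartial_prodfun ?multi_factorD1 -?mpartial_prodfun//; last exact: bumps_dfactor.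
rewrite w2; last exact: prodfun_test.
rewrite dE exprS -mulrA mulrCA => /(mulfI (sgn_neq0 _)) <-.
by rewrite mulN1r.
Qed.

Lemma weak_partial_defect P b i : (mdeg b < m)%N ->
  weak_partial i (defect P b) (defect P (mnm_add b (mnm1 i))).
Proof.
move=> bm; have dE : mdeg (mnm_add b (mnm1 i)) = (mdeg b).+1 by rewrite mdegD mdeg1 addn1.
have iL := Lfun_integrable1 p1.
have E Q (f : T -> R) : f \- pfun Q = f \+ pfun (- Q).
  by apply/funext => x; rewrite /pfun /= mevalN.
rewrite /defect !E; apply: weak_partialD.
- by apply: iL; have [] := wderive_spec su (ltnW bm).
- exact: pfun_integrable.
- by apply: iL; have [] := @wderive_spec m (mnm_add b (mnm1 i)) u su; rewrite ?dE.
- exact: pfun_integrable.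
- exact: weak_partial_wderive.
- rewrite mderivmDm mderivmU1m -mderivN; exact: weak_partial_pfun.
Qed.

Lemma wderive_sub_norm P b : (mdeg b <= m)%N ->
  nm (wderive p b (u \- pfun P)) <= nm (defect P b).
Proof.
move=> bm; have dL := defect_Lfun P bm.
pose D := [set v | v \in Lfun (cube_measure R N) p%:E /\ weak_derivative b (u \- pfun P) v].
(* Without a weak derivative the representative would be the default value 0,
   for which the bound is trivial: existence is not an issue. *)
have [[v Dv]|nD] := pselect (exists v, D v); last first.
  have -> : wderive p b (u \- pfun P) = cst 0.
    by apply: xgetPN => v Dv; apply: nD; exists v.
  by rewrite Lpnorm_cst// normr0 Lpnorm_ge0.
have [wL ww] : D (wderive p b (u \- pfun P)) by apply: (xgetPex (cst 0 : T -> R)); exists v.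
rewrite (weak_derivative_norm_unique wL dL ww)// => F bF.
have [vL wv] := wderive_spec su bm.
have iL := Lfun_integrable1 p1.
have bmF := bumps_bmeas bF; have bmM := bumps_bmeas (multi_factor_bumps b bF).
have iu : u \in Lp by case: su.
transitivity (\int[@cubem R N]_x (u x * mpartial b (prodfun F) x) -
              \int[@cubem R N]_x (pfun P x * mpartial b (prodfun F) x)).
  rewrite mpartial_prodfun// -RintegralB//.
  - by apply: eq_Rintegral => x _; rewrite /= mulrBl.
  - by apply: integrable_mul_prodfun => //; exact: iL.
  - by apply: integrable_mul_prodfun => //; exact: pfun_integrable.
rewrite pfun_weak_derivative// wv; last exact: prodfun_test.
rewrite -mulrBr; congr (_ * _); rewrite -RintegralB//.
- by apply: eq_Rintegral => x _; rewrite /= mulrBl.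
- by apply: integrable_mul_prodfun => //; exact: iL.
- by apply: integrable_mul_prodfun => //; exact: pfun_integrable.
Qed.

End jet.

End sobolev_poincare.

(** * Polynomial approximation of Sobolev functions *)

Section best_approximation.
Variables (R : realType) (N : nat) (p : R).
Hypothesis p1 : 1 <= p.
Local Notation T := 'rV[R]_N.
Local Notation Lp := (Lfun (@cubem R N) p%:E).
Local Notation nm := (@Lpnorm R N p).
Implicit Types (P Q : mpoly N R) (b : multinom N) (u : T -> R).

Lemma gradnorm_ge0 k u : 0 <= gradnorm p k u.
Proof. by apply: sumr_ge0 => b _; exact: Lpnorm_ge0. Qed.

Lemma wderive_le_gradnorm b u : nm (wderive p b u) <= gradnorm p (mdeg b) u.
Proof.
rewrite /gradnorm (bigD1 (BMultinom (ltnSn (mdeg b))))//= lerDl.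
by apply: sumr_ge0 => c _; exact: Lpnorm_ge0.
Qed.

Lemma msize_sum_le (I : Type) (s : seq I) (A : pred I) (Q : I -> mpoly N R) n :
  (forall i, A i -> (msize (Q i) <= n)%N) -> (msize (\sum_(i <- s | A i) Q i)%R <= n)%N.
Proof.
move=> Qn; apply: (big_ind (fun P => (msize P <= n)%N)) => //; first by rewrite msize0.
by move=> P P' Pn Pn'; rewrite (leq_trans (msizeD_le _ _))// geq_max Pn.
Qed.

Lemma mderivm_sum (I : Type) (s : seq I) (A : pred I) (Q : I -> mpoly N R) b :
  mderivm b (\sum_(i <- s | A i) Q i) = \sum_(i <- s | A i) mderivm b (Q i).
Proof. exact: raddf_sum. Qed.

(** The monomials of degree [mdeg b] adjust the derivatives of this order
    independently of each other, without changing those of higher order. *)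
Lemma monomial_adjust b (c : R) : exists Q, [/\ (msize Q <= (mdeg b).+1)%N,
  mderivm b Q = mpolyC N c &
  forall a, (mdeg b <= mdeg a)%N -> a != b -> mderivm a Q = 0].
Proof.
have [d d0 dE] := mderivm_monomial_self R b.
exists ((c / d) *: mpolyX R b); split.
- by rewrite (leq_trans (msizeZ_le _ _))// msizeX.
- by rewrite mderivmZ dE -mul_mpolyC -mpolyCM divfK.
- by move=> a ba ab; rewrite mderivmZ mderivm_monomial_eq0 ?scaler0// eq_sym.
Qed.

(** By downward induction on the order: once the derivatives of order [k + 1] of
    [u - P] are controlled, the Poincare inequality controls those of order
    [k] up to constants, which monomials of degree [k] absorb. *)
Lemma jet_approx m j : (j <= m)%N -> exists2 C : R, 0 <= C &
  forall u, sobolev m p u -> exists P, (msize P <= m)%N /\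
    forall b, (m - j <= mdeg b <= m)%N -> nm (defect p u P b) <= C * gradnorm p m u.
Proof.
have [eta [beta Jeta]] := unit_bump_exists R.
have [C1 C10 poinc] := @poincare1 R N p eta p1 beta Jeta.
elim: j => [_|j IH jm].
  exists 1 => // u su; exists 0; split; first by rewrite msize0.
  move=> b; rewrite subn0 -eqn_leq => /eqP mb; rewrite mul1r mb.
  have -> : defect p u 0 b = wderive p b u.
    by apply/funext => x; rewrite /defect /pfun /= raddf0 meval0 subr0.
  exact: wderive_le_gradnorm.
have [C C0 hC] := IH (ltnW jm).
exists (C + C1 * (C *+ N)); first by rewrite addr_ge0// mulr_ge0// mulrn_wge0.
move=> u su; have [P [Pm hP]] := hC u su.
set G := gradnorm p m u; pose k := (m - j.+1)%N.
have km : (k < m)%N by rewrite /k -subSn// subSS leq_subr.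
have kj : (m - j = k.+1)%N by rewrite /k -subSn// subSS.
have /choice[Q hQ] : forall b : bmultinom N k.+1, exists Q, mdeg b = k ->
    [/\ (msize Q <= k.+1)%N, nm (defect p u P b \- pfun (mderivm b Q)) <= C1 * (C *+ N) * G &
    forall a, (k <= mdeg a)%N -> a != b -> mderivm a Q = 0].
  move=> b; have [bk|nbk] := eqVneq (mdeg b) k; last by exists 0 => /eqP; rewrite (negPf nbk).
  have bm : (mdeg b < m)%N by rewrite bk.
  have dE i : mdeg (mnm_add b (mnm1 i)) = k.+1 by rewrite mdegD mdeg1 addn1 bk.
  have [|||c hc] := poinc (defect p u P b) (fun i => defect p u P (mnm_add b (mnm1 i))).
  - by apply: defect_Lfun su _ _ _ => //; exact: ltnW.
  - by move=> i; apply: defect_Lfun su _ _ _ => //; rewrite dE.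
  - by move=> i; apply: weak_partial_defect su _ _ _ _.
  have [Qb [Q1 Q2 Q3]] := monomial_adjust b c.
  exists Qb => _; split; [by move: Q1; rewrite bk| |by move=> a ka; apply: Q3; rewrite bk].
  have -> : pfun (mderivm b Qb) = cst c :> (T -> R).
    by rewrite Q2; apply/funext => x; rewrite /pfun mevalC.
  apply: (le_trans hc); rewrite -mulrA ler_wpM2l//.
  rewrite (@le_trans _ _ (\sum_(i < N) C * G))//.
    by apply: ler_sum => i _; apply: hP; rewrite dE kj leqnn.
  by rewrite sumr_const card_ord mulrnAl.
exists (P + \sum_(b : bmultinom N k.+1 | mdeg b == k) Q b); split.
  rewrite (leq_trans (msizeD_le _ _))// geq_max Pm /=.
  by apply: msize_sum_le => b /eqP /hQ[h _ _]; exact: leq_trans km.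
have defE a : (k <= mdeg a)%N -> defect p u (P + \sum_(b : bmultinom N k.+1 | mdeg b == k) Q b) a
   = defect p u P a \- pfun (\sum_(b : bmultinom N k.+1 | mdeg b == k) mderivm a (Q b)).
  move=> ka; apply/funext => x; rewrite /defect mderivmD mderivm_sum pfunD /=.
  by rewrite opprD addrA.
move=> a /andP[ka am].
have [ak|nak] := eqVneq (mdeg a) k; last first.
  have ka' : (k < mdeg a)%N by rewrite ltn_neqAle eq_sym nak.
  have -> : defect p u (P + \sum_(b : bmultinom N k.+1 | mdeg b == k) Q b) a = defect p u P a.
    rewrite defE// big1; last first.
      move=> b /eqP bk; have [_ _ ->//] := hQ b bk.
      by apply: contraNneq nak => ->; rewrite bk.
    by apply/funext => x; rewrite /pfun /= meval0 subr0.
  rewrite (le_trans (hP a _)) ?kj ?ka'// mulrDl lerDl mulr_ge0 ?gradnorm_ge0//.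
  by rewrite mulr_ge0// mulrn_wge0.
have ab : (mdeg a < k.+1)%N by rewrite ak.
pose a' := BMultinom ab.
rewrite defE// (bigD1 a')/= ?ak// big1 ?addr0; last first.
  move=> b /andP[/eqP bk ba]; have [_ _ ->//] := hQ b bk.
  by move: ba; rewrite bmeqP eq_sym.
have [_ h _] := hQ a' ak.
rewrite (le_trans h)// mulrDl lerDr mulr_ge0// gradnorm_ge0//.
Qed.

(** [jet_approx], continued down to the order 0. *)
Lemma sobolev_poincare m : (0 < m)%N -> exists2 C : R, 0 <= C &
  forall u, sobolev m p u -> exists P, poly_le m.-1 P /\
    poly_dist m.-1 p u P <= C * gradnorm p m u.
Proof.
move=> m0; have [C C0 hC] := jet_approx (leqnn m).
exists (\sum_(i < m.-1.+1) \sum_(b : bmultinom N i.+1 | mdeg b == i) C).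
  by apply: sumr_ge0 => i _; apply: sumr_ge0.
move=> u su; have [P [Pm hP]] := hC u su; exists P; split.
  by rewrite /poly_le/= prednK.
rewrite /poly_dist mulr_suml; apply: ler_sum => i _.
rewrite /gradnorm mulr_suml; apply: ler_sum => b /eqP bi.
have bm : (mdeg b <= m)%N by rewrite bi ltnW// -[X in (_ < X)%N](prednK m0).
rewrite (le_trans (wderive_sub_norm p1 su P bm))//.
by apply: hP; rewrite subnn.
Qed.

(** The zeroth-order term of the minimized sum already is the [L^p] norm. *)
Lemma projection_error m : (0 < m)%N -> exists2 C : R, 0 <= C &
  forall Pi u, projection m.-1 p Pi -> sobolev m p u ->
    nm (u \- pfun (Pi u)) <= C * gradnorm p m u.
Proof.
move=> m0; have [C C0 hC] := sobolev_poincare m0; exists C => // Pi u hPi su.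
have [P [Pm hP]] := hC u su.
have [_ /(_ P Pm) best] : best_approx m.-1 p u (Pi u) by apply: hPi; rewrite prednK.
rewrite (le_trans _ (le_trans best hP))//.
have uL : (u \- pfun (Pi u)) \in Lp.
  by apply: LfunB => //; [case: su|exact: pfun_Lfun].
rewrite -(wderive0_norm p1 uL) (le_trans (wderive_le_gradnorm _ _))// mdeg0.
rewrite /poly_dist (bigD1 ord0)//= lerDl.
by apply: sumr_ge0 => i _; exact: gradnorm_ge0.
Qed.

End best_approximation.

(** * Nonnegative functions and their linear parts *)

Section nonnegative.
Variables (R : realType) (N : nat) (p : R).
Hypothesis p1 : 1 <= p.
Local Notation T := 'rV[R]_N.
Local Notation Lp := (Lfun (@cubem R N) p%:E).
Local Notation nm := (@Lpnorm R N p).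
Implicit Types (P Q : mpoly N R) (u f : T -> R).

Lemma Lpnorm_opp f : f \in Lp -> nm (fun x => f (- x)) = nm f.
Proof.
move=> fL; have mf := Lfun_measurable fL.
rewrite /Lpnorm unlock /Lnorm; congr (fine (_ `^ _)%E).
apply: (@ge0_integral_opp R N (fun x => (`|(f x)%:E| `^ p)%E)).
  apply: (measurableT_comp (measurable_poweR _)).
  by apply: measurableT_comp => //; exact/measurable_EFinP.
by move=> x; exact: poweR_ge0.
Qed.

Lemma Lpnorm_abs f : f \in Lp ->
  (fun x => `|f x|) \in Lp /\ nm (fun x => `|f x|) <= nm f.
Proof.
move=> fL; apply: Lpnorm_ae_le => //.
  by apply: measurableT_comp => //; exact: Lfun_measurable fL.
by apply: nearW => x; rewrite normr_id.
Qed.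

(** The positive part of an odd function is the reflection of its negative
    part, so both have the same norm. *)
Lemma Lpnorm_odd f : f \in Lp -> (forall x, f (- x) = - f x) ->
  nm f <= 2 * nm (fun x => Num.max (- f x) 0).
Proof.
move=> fL fodd; have mf := Lfun_measurable fL.
have maxL (g : T -> R) : g \in Lp -> (fun x => Num.max (g x) 0) \in Lp.
  move=> gL; have [] // := @Lpnorm_ae_le R N p p1 (fun x => Num.max (g x) 0) g _ gL.
    by apply: measurable_maxr => //; exact: Lfun_measurable gL.
  by apply: nearW => x; case: (leP 0 (g x)) => _; rewrite ?normr0.
have posL := maxL _ fL; have negL := maxL _ (LfunN fL).
rewrite mulr_natl mulr2n.
have {1}-> : f = (fun x => Num.max (f x) 0) \- (fun x => Num.max (- f x) 0).
  by apply/funext => x /=; case: (leP 0 (f x)) => f0; case: (leP 0 (- f x)) => nf0; lra.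
rewrite (le_trans (LpnormB p1 posL negL))// lerD2r.
rewrite -(Lpnorm_opp posL) le_eqVlt; apply/orP; left; apply/eqP; congr Lpnorm.
by apply/funext => x; rewrite fodd.
Qed.

Lemma pihomog_opp d P (x : T) :
  pfun (pihomog mdeg d P) (- x) = (-1) ^+ d * pfun (pihomog mdeg d P) x.
Proof.
rewrite pihomogE -big_filter !pfun_sum mulr_sumr.
rewrite big_filter [RHS]big_filter; apply: eq_bigr => a /eqP ad.
have {}ad : mdeg a = d by exact: ad.
rewrite mulrCA; congr (_ * _); rewrite /pfun !mevalX -ad mdegE -prodrXr.
rewrite -big_split; apply: eq_bigr => i _.
by rewrite mxE/= [LHS]exprNn.
Qed.

Lemma low_part1E P : low_part 1 P = low_part 0 P + pihomog mdeg 1 P.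
Proof. by rewrite /low_part !big_ord_recr !big_ord0. Qed.

(** Since [u] is nonnegative, [u - P] is at least the negative part of the linear
    part of [P] wherever the latter is negative, up to the other terms of [P];
    and this negative part carries half of the norm. *)
Lemma linear_part_le u P : u \in Lp -> {ae @cubem R N, forall x, 0 <= u x} ->
  nm (pfun (pihomog mdeg 1 P)) <=
  2 * (nm (u \- pfun P) + nm (pfun (low_part 0 P)) + nm (pfun (P - low_part 1 P))).
Proof.
move=> uL u0; set l := pihomog mdeg 1 P; set h := P - low_part 1 P.
have pL Q : (pfun Q : T -> R) \in Lp by exact: pfun_Lfun.
have upL : (u \- pfun P) \in Lp by exact: LfunB.
have lodd (x : T) : pfun l (- x) = - pfun l x by rewrite pihomog_opp expr1 mulN1r.
rewrite (le_trans (Lpnorm_odd (pL l) lodd))// ler_wpM2l//.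
have [aL1 ale1] := Lpnorm_abs upL.
have [aL2 ale2] := Lpnorm_abs (pL (low_part 0 P)).
have [aL3 ale3] := Lpnorm_abs (pL h).
have aL12 := LfunD p1 aL1 aL2; have aL123 := LfunD p1 aL12 aL3.
have ml : measurable_fun setT (fun x : T => Num.max (- pfun l x) 0).
  by apply: measurable_maxr => //; apply: measurableT_comp => //; exact: measurable_pfun.
have dom : {ae @cubem R N, forall x, `|Num.max (- pfun l x) 0| <=
    `|(((fun x => `|(u \- pfun P) x|) \+ (fun x => `|pfun (low_part 0 P) x|))
       \+ (fun x => `|pfun h x|)) x|}.
  apply: filterS u0 => x ux /=.
  rewrite ger0_norm ?le_max ?lexx ?orbT//.
  rewrite ger0_norm; last by rewrite !addr_ge0.
  rewrite ge_max; apply/andP; split; last by rewrite !addr_ge0.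
  have PE : pfun P x = pfun (low_part 0 P) x + pfun l x + pfun h x.
    by rewrite /h low_part1E /pfun -!mevalD addrC subrK.
  have h1 : u x - pfun P x <= `|u x - pfun P x| by exact: ler_norm.
  have h2 : pfun (low_part 0 P) x <= `|pfun (low_part 0 P) x| by exact: ler_norm.
  have h3 : pfun h x <= `|pfun h x| by exact: ler_norm.
  by move: h1; rewrite {1}PE => h1; lra.
have [_ le] := Lpnorm_ae_le p1 ml aL123 dom.
rewrite (le_trans le)// (le_trans (LpnormD p1 aL12 aL3))// lerD//.
by rewrite (le_trans (LpnormD p1 aL1 aL2))// lerD.
Qed.

End nonnegative.

Theorem theorem2p27 (R : realType) (N m : nat) (p : R)
    (N_gt0 : (0 < N)%N) (m_ge2 : (2 <= m)%N) (p_ge1 : 1 <= p) :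
  exists2 alpha0 : R, 0 < alpha0 &
  forall alpha : R, alpha0 <= alpha ->
  exists alpha' c : R, 0 < alpha' /\ 0 < c /\
  forall (Pi : ('rV[R]_N -> R) -> mpoly N R) (A : set ('rV[R]_N -> R)),
    projection m.-1 p Pi ->
    A `<=` sobolev m p ->
    (forall u, A u -> {ae cube_measure R N, forall x, 0 <= u x}) ->
    (c%:E * Theta p Pi alpha' m 0 A <= Theta p Pi alpha m 1 A)%E.
Proof.
have p0 : 0 < p by exact: lt_le_trans p_ge1.
have [C C0 hC] := @projection_error R N p p_ge1 m (ltnW m_ge2).
(* 19 serves the case of a large constant term, where
   [M <= 17 * A0' + M / 16]; 3 * C the other one, where [M <= 3 * E]. *)
pose K := 19 + 3 * C.
have K1 : 1 <= K by rewrite /K; lra.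
have K0 : 0 < K by exact: lt_le_trans K1.
exists 16 => // alpha alpha16; exists (16^-1), (K^-1 `^ p).
split; first by rewrite invr_gt0.
split; first by rewrite powR_gt0// invr_gt0.
move=> Pi A hPi AS A0.
have c0 : 0 <= K^-1 `^ p by exact: powR_ge0.
rewrite {2}/Theta le_min; apply/andP; split; last first.
  rewrite (@le_trans _ _ ((K^-1 `^ p)%:E * 1)%E)//.
    by rewrite lee_wpmul2l ?lee_fin// /Theta ge_min lexx orbT.
  rewrite mule1 lee_fin (@le_trans _ _ (1 `^ p))//; last by rewrite powR1.
  apply: ge0_ler_powR; rewrite ?nnegrE ?invr_ge0 ?invf_le1 ?(ltW p0) ?(ltW K0)//.
apply: le_ereal_inf_tmp => _ [u [[Au Tu Eu] unz] <-].
have su := AS _ Au.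
have uL : u \in Lfun (@cubem R N) p%:E by case: su.
have pL Q : (pfun Q : 'rV[R]_N -> R) \in Lfun (@cubem R N) p%:E by exact: pfun_Lfun.
set P := Pi u in Tu Eu.
rewrite /Pi_co /Pi_low -/P in Tu Eu *.
have hE := hC Pi u hPi su; rewrite -/P in hE.
have hl := linear_part_le p_ge1 P uL (A0 u Au).
move: Eu Tu hE hl.
set G := gradnorm p m u.
set E := Lpnorm p (u \- pfun P).
set M := Lpnorm p (pfun (low_part 1 P)).
set H := Lpnorm p (pfun (P - low_part 1 P)).
set L := Lpnorm p (pfun (pihomog mdeg 1 P)).
set A0' := Lpnorm p (pfun (low_part 0 P)).
move=> Eu Tu hE hl.
have G0 : 0 <= G by exact: gradnorm_ge0.
have M0 : 0 <= M by exact: Lpnorm_ge0.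
have H0 : 0 <= H by exact: Lpnorm_ge0.
have a0 : 0 <= A0' by exact: Lpnorm_ge0.
have E0 : 0 <= E by exact: Lpnorm_ge0.
have HM : 16 * H <= M by rewrite (le_trans _ Tu)// ler_wpM2r.
have triangle Q1 Q2 : Lpnorm p (pfun (Q1 + Q2) : 'rV[R]_N -> R) <= Lpnorm p (pfun Q1) + Lpnorm p (pfun Q2).
  by rewrite pfunD; exact: LpnormD.
have Mpos : 0 < M.
  rewrite lt_neqAle M0 andbT; apply/eqP => M00; apply: unz.
  have nP : Lpnorm p (pfun P : 'rV[R]_N -> R) <= 0.
    have := triangle (low_part 1 P) (P - low_part 1 P); rewrite addrC subrK -/M -/H.
    move: HM; rewrite -M00; lra.
  apply: (Lpnorm_eq0 p_ge1 uL); apply/eqP; rewrite eq_le Lpnorm_ge0 andbT.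
  have -> : u = (u \- pfun P) \+ pfun P by apply/funext => x /=; rewrite subrK.
  rewrite (le_trans (LpnormD p_ge1 (LfunB p_ge1 uL (pL P)) (pL P)))//.
  by rewrite -/E; lra.
have ratio X : 0 <= X -> M <= K * X -> K^-1 `^ p <= X `^ p / M `^ p.
  move=> X0 MX; rewrite ler_pdivlMr ?powR_gt0// -powRM ?invr_ge0 ?(ltW K0)//.
  apply: ge0_ler_powR; rewrite ?nnegrE ?(ltW p0) ?mulr_ge0 ?invr_ge0 ?(ltW K0)//.
  by rewrite mulrC ler_pdivrMr// mulrC.
(* Either the constant term is not small, and [u] is a competitor for the order
   0; or the linear part dominates, and nonnegativity makes the ratio large. *)
have [T0|nT0] := leP (16^-1 * Lpnorm p (pfun (P - low_part 0 P) : 'rV[R]_N -> R)) A0'.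
  have MA : M <= K * A0'.
    have := triangle (low_part 0 P) (P - low_part 0 P); rewrite addrC subrK => t1.
    have t2 : M <= Lpnorm p (pfun P : 'rV[R]_N -> R) + H.
      have -> : M = Lpnorm p (pfun P \- pfun (P - low_part 1 P) : 'rV[R]_N -> R).
        by rewrite -pfunB opprB addrC subrK.
      exact: LpnormB.
    move: t1; rewrite -/A0' => t1.
    have : M <= 19 * A0' by lra.
    by move=> /le_trans; apply; rewrite ler_wpM2r// /K; lra.
  have A0pos : 0 < A0'.
    rewrite lt_neqAle a0 andbT; apply/eqP => A00.
    by move: MA; rewrite -A00 mulr0 leNgt Mpos.
  have le1 : (Theta p Pi 16^-1 m 0 A <= (G `^ p / A0' `^ p)%:E)%E.
    rewrite /Theta ge_min; apply/orP; left; apply: ereal_inf_lbound.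
    by exists u.
  rewrite (le_trans (lee_wpmul2l _ le1))//.
  rewrite -EFinM lee_fin.
  have A0p : A0' `^ p != 0 by rewrite gt_eqF// powR_gt0.
  have := ler_wpM2r (divr_ge0 (powR_ge0 G p) (powR_ge0 A0' p)) (ratio _ a0 MA).
  by move=> /le_trans; apply; rewrite mulrC mulrA divfK.
rewrite (@le_trans _ _ ((K^-1 `^ p)%:E * 1)%E)//.
  by rewrite lee_wpmul2l ?lee_fin// /Theta ge_min lexx orbT.
rewrite mule1 lee_fin; apply: ratio => //.
have hPl : P - low_part 0 P = pihomog mdeg 1 P + (P - low_part 1 P).
  by rewrite low_part1E opprD addrCA; congr (_ + _); rewrite addrCA subrr addr0.
have := triangle (pihomog mdeg 1 P) (P - low_part 1 P); rewrite -hPl -/L -/H => t1.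
have := triangle (low_part 0 P) (pihomog mdeg 1 P); rewrite -low_part1E -/M -/L -/A0' => t2.
have : M <= 3 * E by lra.
move=> /le_trans; apply; rewrite (le_trans (ler_wpM2l _ hE))//.
by rewrite mulrA ler_wpM2r// /K; lra.
Qed.
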